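(* Let $G$ be a compact Lie group, let $\tau$ be a non-trivial irreducible (finite-dimensional complex) representation of $G$ with real-valued character $\chi^\tau$, and fix a self-inverse conjugacy class of $G$ with representative $\alpha$. Let $(W,W')$ be the pair $W=\chi^\tau(g)$, $W'=\chi^\tau(\alpha' g)$, where $g$ is chosen from Haar measure on $G$ and, independently, $\alpha'$ is chosen uniformly at random from the conjugacy class of $\alpha$. Let $k$ be a positive integer. Then: (1) $\displaystyle \mathbb{E}\left[(W'-W)^k\right] = \sum_{r=0}^k (-1)^{k-r} \binom{k}{r} \sum_{\phi}m_{\phi}(\tau^r)\, m_{\phi}(\tau^{k-r})\,\frac{\chi^{\phi}(\alpha)}{\dim(\phi)}$; (2) $\displaystyle \mathbb{E}\left[(W'-W)^4\right] = \sum_{\phi} m_{\phi}(\tau^2)^2\left[ 8 \left(1 - \frac{\chi^{\tau}(\alpha)}{\dim(\tau)} \right) - 6\left(1-\frac{\chi^{\phi}(\alpha)}{\dim(\phi)} \right) \right]$. The sums over $\phi$ are over all irreducible representations of $G$.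
   Context: Haar measure is normalized to be a probability measure. A conjugacy class is self-inverse if it contains the inverse of each of its elements. Choosing $\alpha'$ uniformly from the conjugacy class of $\alpha$ means $\alpha'=h\alpha h^{-1}$ with $h$ Haar distributed on $G$. For an irreducible representation $\phi$, $\chi^\phi$ is its character, $\dim(\phi)$ its dimension, and $m_{\phi}(\tau^r)$ is the multiplicity of $\phi$ in the $r$-fold tensor product of $\tau$ (which has character $(\chi^{\tau})^r$; for $r=0$ this is the trivial representation). Sums are over isomorphism classes of irreducible representations. *)

(* Defs.v *)
From HB Require Import structures.
#[warnings="-notation-overridden,-ambiguous-paths,-notation-incompatible-prefix"]
From mathcomp Require Import all_boot all_order all_algebra all_character.
#[warnings="-notation-overridden,-ambiguous-paths,-notation-incompatible-prefix"]
From mathcomp Require Import complex.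
#[warnings="-notation-overridden,-ambiguous-paths,-notation-incompatible-prefix"]
From mathcomp Require Import all_classical all_reals all_analysis.

Set Implicit Arguments.
Unset Strict Implicit.
Unset Printing Implicit Defensive.

Import Order.TTheory GRing.Theory Num.Theory.
Import numFieldNormedType.Exports.

Local Open Scope classical_set_scope.
Local Open Scope ring_scope.
Local Open Scope complex_scope.

HB.mixin Record isTopologicalGroup G of Group G & PointedTopological G := {
  mulg_continuous : continuous (fun xy : G * G => (xy.1 * xy.2)%g : G);
  invg_continuous : continuous (fun x : G => x^-1%g : G)
}.

#[short(type="topologicalGroupType")]
HB.structure Definition TopologicalGroup :=
  {G of Group G & PointedTopological G & isTopologicalGroup G}.

Section Smooth.
Context {R : realType} {V W : normedModType R}.

(* C^k on A (meant for A open), phrased with directional derivatives: in finite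
   dimension f is C^(k+1) iff it is continuous and all its directional
   derivatives exist and are C^k. *)
Fixpoint Ck (k : nat) (A : set V) (f : V -> W) : Prop :=
  (forall x, A x -> {for x, continuous f}) /\
  if k is k'.+1 then
    forall v, (forall x, A x -> derivable f x v) /\ Ck k' A (fun x => 'D_v f x)
  else True.

Definition smooth (A : set V) (f : V -> W) : Prop := forall k, Ck k A f.

End Smooth.

(* Only the values of [chart_map] on [chart_dom], and those of [chart_inv] on
   the image of [chart_dom], are meaningful. *)
Record chart (R : realType) (n : nat) (G : Type) := Chart {
  chart_dom : set G;
  chart_map : G -> 'rV[R]_n;
  chart_inv : 'rV[R]_n -> G
}.

Definition chart_codom (R : realType) (n : nat) (G : Type) (c : chart R n G) :
  set 'rV[R]_n := chart_map c @` chart_dom c.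

Definition chart_homeo (R : realType) (n : nat) (G : topologicalType)
    (c : chart R n G) : Prop :=
  [/\ open (chart_dom c), open (chart_codom c),
      forall x, chart_dom c x -> chart_inv c (chart_map c x) = x,
      forall x, chart_dom c x -> {for x, continuous (chart_map c)} &
      forall y, chart_codom c y -> {for y, continuous (chart_inv c)}].

(* A Lie group is homogeneous, hence of pure dimension. *)
HB.mixin Record isLieGroup (R : realType) G of TopologicalGroup G := {
  lie_hausdorff : hausdorff_space G;
  lie_second_countable : @second_countable G;
  lie_dim : nat;
  lie_atlas : set (chart R lie_dim G);
  lie_chart_homeo : forall c, lie_atlas c -> chart_homeo c;
  lie_cover : forall x : G, exists2 c, lie_atlas c & chart_dom c x;
  lie_transition_smooth : forall c d, lie_atlas c -> lie_atlas d ->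
    smooth [set y | chart_codom c y /\ chart_dom d (chart_inv c y)]
           (fun y => chart_map d (chart_inv c y));
  lie_mul_smooth : forall c d e, lie_atlas c -> lie_atlas d -> lie_atlas e ->
    smooth [set y : 'rV[R]_lie_dim * 'rV[R]_lie_dim |
              [/\ chart_codom c y.1, chart_codom d y.2 &
                  chart_dom e (chart_inv c y.1 * chart_inv d y.2)%g]]
           (fun y => chart_map e (chart_inv c y.1 * chart_inv d y.2)%g);
  lie_inv_smooth : forall c d, lie_atlas c -> lie_atlas d ->
    smooth [set y | chart_codom c y /\ chart_dom d ((chart_inv c y)^-1)%g]
           (fun y => chart_map d ((chart_inv c y)^-1)%g)
}.

#[short(type="lieGroupType")]
HB.structure Definition LieGroup (R : realType) :=
  {G of TopologicalGroup G & isLieGroup R G}.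

Section ConjugacyClass.
Context {G : groupType}.

Definition conj_class (a : G) : set G :=
  [set (h * a * h^-1)%g | h in [set: G]].

Definition self_inverse_class (C : set G) : Prop := forall x, C x -> C (x^-1)%g.

End ConjugacyClass.

Section Haar.

Definition borelType (G : topologicalGroupType) := g_sigma_algebraType (@open G).

(* On a compact (unimodular) group left invariance characterizes the normalized
   Haar measure; on a compact Lie group every finite Borel measure is regular. *)
Definition is_haar (R : realType) (G : topologicalGroupType)
    (mu : probability (borelType G) R) : Prop :=
  forall (g : G) (A : set (borelType G)), measurable A ->
    mu ((fun x : G => g * x)%g @^-1` A) = mu A.

Definition has_law (R : realType) d (Omega : measurableType d)
    d' (T : measurableType d') (P : probability Omega R) (X : {RV P >-> T})
    (nu : set T -> \bar R) : Prop :=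
  forall A, measurable A -> distribution P X A = nu A.

Definition uniform_conj_class (R : realType) (G : topologicalGroupType)
    (mu : probability (borelType G) R) (a : G) : set (borelType G) -> \bar R :=
  pushforward mu (fun h : G => (h * a * h^-1)%g : borelType G).

Definition independent_RV (R : realType) d (Omega : measurableType d)
    d1 (T1 : measurableType d1) d2 (T2 : measurableType d2)
    (P : probability Omega R) (X : {RV P >-> T1}) (Y : {RV P >-> T2}) : Prop :=
  forall A B, measurable A -> measurable B ->
    P (X @^-1` A `&` Y @^-1` B) = (P (X @^-1` A) * P (Y @^-1` B))%E.

End Haar.

Arguments has_law {R d Omega d' T} P X nu.
Arguments independent_RV {R d Omega d1 T1 d2 T2} P X Y.

Section Representation.
Context {R : realType}.
Local Notation C := R[i].

(* Continuity for the usual topology of the complex plane. *)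
Definition ccontinuous (T : topologicalType) (f : T -> C) : Prop :=
  continuous (fun x => complex.Re (f x)) /\
  continuous (fun x => complex.Im (f x)).

Section CContinuous.
Context {T : topologicalType}.
Implicit Types f g : T -> C.

Lemma ccontinuous_cst (c : C) : ccontinuous (fun _ : T => c).
Proof. by split=> x; exact: cvg_cst. Qed.

Lemma ccontinuousM f g :
  ccontinuous f -> ccontinuous g -> ccontinuous (fun x => f x * g x).
Proof.
move=> [fr fi] [gr gi]; split=> x.
- rewrite (_ : (fun y => _) = fun y => complex.Re (f y) * complex.Re (g y)
      - complex.Im (f y) * complex.Im (g y)); last first.
    by apply/funext => y; case: (f y) (g y) => a b [].
  by apply: cvgB; apply: cvgM; [exact: fr|exact: gr|exact: fi|exact: gi].
- rewrite (_ : (fun y => _) = fun y => complex.Re (f y) * complex.Im (g y)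
      + complex.Im (f y) * complex.Re (g y)); last first.
    by apply/funext => y; case: (f y) (g y) => a b [].
  by apply: cvgD; apply: cvgM; [exact: fr|exact: gi|exact: fi|exact: gr].
Qed.

End CContinuous.

Section OverGroup.
Context {G : topologicalGroupType}.

(* A representation on the space of column vectors of size [rdim]. *)
Record rep := Rep {
  rdim : nat;
  rmx :> G -> 'M[C]_rdim;
  rmx1 : rmx 1%g = 1%:M;
  rmxM : forall x y, rmx (x * y)%g = rmx x *m rmx y;
  rmx_continuous : forall i j, ccontinuous (fun x => rmx x i j)
}.

HB.instance Definition _ := gen_eqMixin rep.
HB.instance Definition _ := gen_choiceMixin rep.

Definition rep_char (phi : rep) (x : G) : C := \tr (phi x).

Definition rep_irreducible (phi : rep) : Prop :=
  (0 < rdim phi)%N /\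
  forall U : {vspace 'cV[C]_(rdim phi)},
    (forall x u, u \in U -> phi x *m u \in U) -> U = 0%VS \/ U = fullv.

Definition rep_iso (phi psi : rep) : Prop :=
  exists (A : 'M[C]_(rdim psi, rdim phi)) (B : 'M[C]_(rdim phi, rdim psi)),
    [/\ A *m B = 1%:M, B *m A = 1%:M & forall x, A *m phi x = psi x *m A].

Program Definition rep_triv : rep :=
  @Rep 1 (fun=> 1%:M) _ _ _.
Next Obligation. by []. Qed.
Next Obligation. by move=> x y; rewrite mulmx1. Qed.
Next Obligation. by move=> i j; exact: ccontinuous_cst. Qed.

Program Definition rep_zero : rep :=
  @Rep 0 (fun=> 1%:M) _ _ _.
Next Obligation. by []. Qed.
Next Obligation. by move=> x y; rewrite mulmx1. Qed.
Next Obligation. by move=> i j; exact: ccontinuous_cst. Qed.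

Program Definition rep_sum (phi psi : rep) : rep :=
  @Rep (rdim phi + rdim psi) (fun x => block_mx (phi x) 0 0 (psi x)) _ _ _.
Next Obligation. by move=> phi psi /=; rewrite !rmx1 -scalar_mx_block. Qed.
Next Obligation.
move=> phi psi x y /=.
by rewrite mulmx_block !rmxM !(mulmx0, mul0mx, addr0, add0r).
Qed.
Next Obligation.
move=> phi psi i j /=; rewrite (_ : (fun x => _) = fun x =>
    match fintype.split i, fintype.split j with
    | inl i1, inl j1 => phi x i1 j1
    | inr i1, inr j1 => psi x i1 j1
    | _, _ => 0 end); last first.
  by apply/funext => x; rewrite !mxE;
     case: (fintype.split i) => ?; rewrite !mxE; case: (fintype.split j) => ?; rewrite ?mxE.
case: (fintype.split i) => i1; case: (fintype.split j) => j1;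
  by [exact: rmx_continuous | exact: ccontinuous_cst].
Qed.

Lemma tprod_entry (F : fieldType) m1 n1 m2 n2
    (i : 'I_(m1 * m2)) (j : 'I_(n1 * n2)) :
  exists i1 j1 i2 j2, forall (A : 'M[F]_(m1, n1)) (B : 'M[F]_(m2, n2)),
    tprod A B i j = A i1 j1 * B i2 j2.
Proof.
have trow_entry : forall n (k : 'I_m2) (l : 'I_(n * n2)),
    exists l1 l2, forall (u : 'rV[F]_n) (B : 'M[F]_(m2, n2)),
      trow u B k l = u 0 l1 * B k l2.
  elim=> [k [] //|n IH k l]; case: (splitP (l : 'I_(n2 + n * n2))) => l' ll'.
    exists ord0, l' => u B /=; rewrite mxE.
    rewrite (_ : fintype.split _ = inl l') ?mxE ?ord1; last first.
      by rewrite -(unsplitK (inl l')); congr fintype.split; exact: val_inj.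
    by congr (u _ _ * _); exact: val_inj.
  have [l1 [l2 h]] := IH k l'; exists (rshift 1 l1), l2 => u B /=; rewrite mxE.
  rewrite (_ : fintype.split _ = inr l') ?h ?mxE //.
  by rewrite -(unsplitK (inr l')); congr fintype.split; exact: val_inj.
elim: m1 i => [[] //|m1 IH i]; case: (splitP (i : 'I_(m2 + m1 * m2))) => i' ii'.
  have [l1 [l2 h]] := trow_entry n1 i' j; exists ord0, l1, i', l2 => A B /=.
  rewrite mxE (_ : fintype.split _ = inl i') ?h ?mxE; last first.
    by rewrite -(unsplitK (inl i')); congr fintype.split; exact: val_inj.
  by congr (A _ _ * _); exact: val_inj.
have [i1 [j1 [i2 [j2 h]]]] := IH i'.
exists (rshift 1 i1), j1, i2, j2 => A B /=; rewrite mxE.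
rewrite (_ : fintype.split _ = inr i') ?h ?mxE //.
by rewrite -(unsplitK (inr i')); congr fintype.split; exact: val_inj.
Qed.

Program Definition rep_tensor (phi psi : rep) : rep :=
  @Rep (rdim phi * rdim psi) (fun x => tprod (phi x) (psi x)) _ _ _.
Next Obligation. by move=> phi psi /=; rewrite !rmx1 tprod1. Qed.
Next Obligation. by move=> phi psi x y /=; rewrite !rmxM tprodE. Qed.
Next Obligation.
move=> phi psi i j /=; have [i1 [j1 [i2 [j2 h]]]] := tprod_entry C i j.
under eq_fun do rewrite h.
by apply: ccontinuousM; exact: rmx_continuous.
Qed.

Definition rep_tensor_pow (tau : rep) (r : nat) : rep :=
  iter r (rep_tensor tau) rep_triv.

Definition rep_bigsum (s : seq rep) : rep := foldr rep_sum rep_zero s.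

(* The number of summands isomorphic to phi in a decomposition of rho into
   irreducible representations. *)
Definition rep_mult (phi rho : rep) : nat :=
  xget 0%N [set m | exists s : seq rep,
    [/\ forall i, (i < size s)%N -> rep_irreducible (nth rep_triv s i),
        rep_iso rho (rep_bigsum s) &
        m = count (fun psi => `[< rep_iso phi psi >]) s]].

(* Selects a representative in each isomorphism class of representations. *)
Definition rep_choice (phi : rep) : rep := xget rep_triv [set psi | rep_iso phi psi].

(* A transversal of the isomorphism classes of irreducible representations. *)
Definition irr_dual : set rep :=
  [set phi | rep_irreducible phi /\ rep_choice phi = phi].

Lemma rep_iso_refl (phi : rep) : rep_iso phi phi.
Proof. by exists 1%:M, 1%:M; split=> [||x]; rewrite ?mulmx1 ?mul1mx. Qed.

Lemma rep_iso_sym (phi psi : rep) : rep_iso phi psi -> rep_iso psi phi.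
Proof.
move=> [A [B [AB BA hA]]]; exists B, A; split=> // x.
by rewrite -[LHS]mulmx1 -AB mulmxA -(mulmxA B) -hA mulmxA BA mul1mx.
Qed.

Lemma rep_iso_trans (phi psi rho : rep) :
  rep_iso phi psi -> rep_iso psi rho -> rep_iso phi rho.
Proof.
move=> [A [B [AB BA hA]]] [A' [B' [AB' BA' hA']]].
exists (A' *m A), (B *m B'); split=> [||x].
- by rewrite mulmxA -(mulmxA A') AB mulmx1.
- by rewrite mulmxA -(mulmxA B) BA' mulmx1.
- by rewrite -mulmxA hA mulmxA hA' mulmxA.
Qed.

Lemma rep_iso_irreducible (phi psi : rep) :
  rep_iso phi psi -> rep_irreducible phi -> rep_irreducible psi.
Proof.
move=> [A [B [AB BA hA]]] [phi0 phiI]; split.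
  rewrite lt0n; apply: contraTneq phi0 => psi0; rewrite -eqn0Ngt.
  rewrite -leqn0 -psi0 -(mxrank1 C (rdim phi)) -BA.
  by apply: leq_trans (mxrankM_maxr _ _) _; exact: rank_leq_row.
move=> U stU; pose U' := (linfun (mulmx A) @^-1: U)%VS.
have U'E u : (u \in U') = (A *m u \in U) by rewrite -memv_preim lfunE.
have BU u : u \in U -> B *m u \in U' by rewrite U'E mulmxA AB mul1mx.
have [x u|U'0|U'T] := phiI U'.
- by rewrite !U'E mulmxA hA -mulmxA; exact: stU.
- left; apply/eqP; rewrite -subv0; apply/subvP => u /BU.
  rewrite U'0 !memv0 => /eqP Bu0.
  by rewrite -[u]mul1mx -AB -mulmxA Bu0 mulmx0.
- right; apply/eqP; rewrite eqEsubv subvf /=; apply/subvP => u _.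
  by rewrite -[u]mul1mx -AB -mulmxA -U'E U'T memvf.
Qed.

Lemma irr_dualP (phi : rep) : rep_irreducible phi ->
  exists! psi, irr_dual psi /\ rep_iso phi psi.
Proof.
move=> irr; have iso_c : rep_iso phi (rep_choice phi).
  by rewrite /rep_choice; case: xgetP => [psi -> //|/(_ phi)[]];
     exact: rep_iso_refl.
have choice_eq psi : rep_iso phi psi -> rep_choice psi = rep_choice phi.
  move=> h; congr xget; apply/seteqP; split=> rho /= h'.
    exact: rep_iso_trans h h'.
  exact: rep_iso_trans (rep_iso_sym h) h'.
exists (rep_choice phi); split=> [|psi [[_ e] h]]; last by rewrite -e -(choice_eq psi h).
split=> //; split; first exact: rep_iso_irreducible iso_c irr.
exact: choice_eq.
Qed.

End OverGroup.
End Representation.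

Arguments rep R G : clear implicits.
Arguments rep_triv R G : clear implicits.
Arguments irr_dual R G : clear implicits.

(* Main.v *)
(* For an irreducible phi the average of phi over the conjugacy class of alpha
   commutes with phi, so by Schur's lemma it is the scalar
   chi_phi(alpha) / dim(phi). Decomposing chi_tau^r into irreducible characters
   and using independence, E[W'^r W^t] becomes the sum over the constituents phi
   of tau^r of that scalar times the mean of chi_phi chi_tau^t. As chi_tau is
   real and chi(x^-1) is the conjugate of chi(x), orthogonality of characters
   turns this mean into m_phi(tau^t); the binomial formula gives (1). For (2),
   the terms r and 4 - r agree, and the terms r = 0 and r = 1 are multiples of
   the fourth moment of chi_tau, which is the sum of the m_phi(tau^2)^2. *)
Require Import Defs.
From HB Require Import structures.
From mathcomp Require Import all_boot all_order all_algebra all_character.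
From mathcomp Require Import complex.
From mathcomp Require Import all_classical all_reals all_analysis.
From mathcomp Require Import measurable_realfun ring.

Set Implicit Arguments.
Unset Strict Implicit.
Unset Printing Implicit Defensive.

Import Order.TTheory GRing.Theory Num.Theory.
Import numFieldNormedType.Exports.

Local Open Scope classical_set_scope.
Local Open Scope ring_scope.
Local Open Scope complex_scope.

(** * Expectation of bounded complex random variables *)

(** Orthogonality, complete reducibility and the identity chi(x^-1) = conj(chi(x)) all come from one
    device, the left Haar average of a matrix-valued function; compactness makes every integrand
    bounded, so integrability is automatic. Two points need care. [rep_mult] picks some
    decomposition, with a default value if there is none: expressing the count as an integral of
    characters shows that it does not depend on the pick, and complete reducibility excludes the
    default. The sums over [irr_dual] run over a possibly infinite set and can be manipulated only
    where their support is finite: each one is rewritten as a sum over a finite list of irreducible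
    constituents of a tensor power of [tau]. The moments in the statement are real while the
    computation is complex, so a complex expectation is defined componentwise and compared with the
    real one at the end. *)

Section BoundedMeasurable.
Context {R : realType} {d : measure_display} {T : measurableType d}.
Local Notation C := R[i].
Implicit Types (f g : T -> R) (F H : T -> C).

(** Boundedness is tracked instead of integrability because it is stable under products; for a
    probability measure it implies integrability. *)
Definition bounded_measurable f : Prop :=
  measurable_fun setT f /\ exists M, forall x, `|f x| <= M.

Lemma bounded_measurable_cst (c : R) : bounded_measurable (fun=> c).
Proof. by split; [exact: measurable_cst | exists `|c|]. Qed.

Lemma bounded_measurableD f g :
  bounded_measurable f -> bounded_measurable g ->
  bounded_measurable (fun x => f x + g x).
Proof.
move=> [mf [M hM]] [mg [N hN]]; split; first exact: measurable_funD.
by exists (M + N) => x; rewrite (le_trans (ler_normD _ _))// lerD.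
Qed.

Lemma bounded_measurableM f g :
  bounded_measurable f -> bounded_measurable g ->
  bounded_measurable (fun x => f x * g x).
Proof.
move=> [mf [M hM]] [mg [N hN]]; split; first exact: measurable_funM.
by exists (M * N) => x; rewrite normrM ler_pM.
Qed.

Lemma bounded_measurableN f :
  bounded_measurable f -> bounded_measurable (fun x => - f x).
Proof.
move=> [mf [M hM]]; split; first exact: measurableT_comp.
by exists M => x; rewrite normrN.
Qed.

Definition cbounded_measurable F : Prop :=
  bounded_measurable (fun x => complex.Re (F x)) /\
  bounded_measurable (fun x => complex.Im (F x)).

Lemma cbounded_measurable_cst (c : C) : cbounded_measurable (fun=> c).
Proof. by split; exact: bounded_measurable_cst. Qed.

Lemma cbounded_measurableD F H :
  cbounded_measurable F -> cbounded_measurable H ->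
  cbounded_measurable (fun x => F x + H x).
Proof.
move=> [Fr Fi] [Hr Hi]; split.
  by under eq_fun do rewrite raddfD; exact: bounded_measurableD.
by under eq_fun do rewrite raddfD; exact: bounded_measurableD.
Qed.

Lemma ReM (a b : C) :
  complex.Re (a * b) =
  complex.Re a * complex.Re b - complex.Im a * complex.Im b.
Proof. by case: a b => a a' []. Qed.

Lemma ImM (a b : C) :
  complex.Im (a * b) =
  complex.Re a * complex.Im b + complex.Im a * complex.Re b.
Proof. by case: a b => a a' []. Qed.

Lemma cbounded_measurableM F H :
  cbounded_measurable F -> cbounded_measurable H ->
  cbounded_measurable (fun x => F x * H x).
Proof.
move=> [Fr Fi] [Hr Hi]; split.
  under eq_fun do rewrite ReM.
  apply: bounded_measurableD; last apply: bounded_measurableN;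
    exact: bounded_measurableM.
under eq_fun do rewrite ImM.
by apply: bounded_measurableD; exact: bounded_measurableM.
Qed.

Lemma cbounded_measurable_conj F :
  cbounded_measurable F -> cbounded_measurable (fun x => conjc (F x)).
Proof.
move=> [Fr Fi]; split.
  rewrite (_ : (fun x => _) = fun x => complex.Re (F x))//.
  by apply/funext => x; case: (F x).
rewrite (_ : (fun x => _) = fun x => - complex.Im (F x)).
  exact: bounded_measurableN.
by apply/funext => x; case: (F x).
Qed.

Lemma cbounded_measurable_sum (I : Type) (s : seq I) (p : pred I)
    (F : I -> T -> C) :
  (forall i, cbounded_measurable (F i)) ->
  cbounded_measurable (fun x => \sum_(i <- s | p i) F i x).
Proof.
move=> mF; elim: s => [|i s IH].
  by under eq_fun do rewrite big_nil; exact: cbounded_measurable_cst.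
under eq_fun do rewrite big_cons; case: (p i) => //.
exact: cbounded_measurableD.
Qed.

Lemma cbounded_measurableX F n :
  cbounded_measurable F -> cbounded_measurable (fun x => F x ^+ n).
Proof.
move=> mF; elim: n => [|n IH].
  by under eq_fun do rewrite expr0; exact: cbounded_measurable_cst.
by under eq_fun do rewrite exprS; exact: cbounded_measurableM.
Qed.

End BoundedMeasurable.

Lemma bounded_measurable_comp (R : realType) d (T : measurableType d)
    d' (T' : measurableType d') (f : T' -> R) (X : T -> T') :
  measurable_fun setT X -> bounded_measurable f -> bounded_measurable (f \o X).
Proof.
move=> mX [mf [M hM]]; split; last by exists M => x /=.
exact: measurableT_comp.
Qed.

Lemma cbounded_measurable_comp (R : realType) d (T : measurableType d)
    d' (T' : measurableType d') (F : T' -> R[i]) (X : T -> T') :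
  measurable_fun setT X -> cbounded_measurable F ->
  cbounded_measurable (F \o X).
Proof.
by move=> mX [Fr Fi]; split; [exact: (bounded_measurable_comp mX Fr)|
                              exact: (bounded_measurable_comp mX Fi)].
Qed.

Section ComplexExpectation.
Context {R : realType} {d : measure_display} {T : measurableType d}
  (mu : probability T R).
Local Notation C := R[i].
Implicit Types (f g : T -> R) (F H : T -> C).

Lemma bounded_measurable_integrable f :
  bounded_measurable f -> mu.-integrable setT (EFin \o f).
Proof.
move=> [mf [M hM]]; apply: measurable_bounded_integrable => //.
  by rewrite (le_lt_trans (probability_le1 _ _))// ltry.
exists M; split; first exact: num_real.
by move=> N MN x _ /=; rewrite (le_trans (hM x))// ltW.
Qed.

Definition cE F : C :=
  (\int[mu]_x complex.Re (F x) : R) +i* (\int[mu]_x complex.Im (F x) : R).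

Lemma eq_cE F H : F =1 H -> cE F = cE H.
Proof. by move=> /funext ->. Qed.

Lemma cE_cst (c : C) : cE (fun=> c) = c.
Proof.
have mu1 : fine (mu setT) = 1 by rewrite probability_setT.
by rewrite /cE !Rintegral_cst// mu1 !mulr1; case: c.
Qed.

Lemma cED F H : cbounded_measurable F -> cbounded_measurable H ->
  cE (fun x => F x + H x) = cE F + cE H.
Proof.
move=> [/bounded_measurable_integrable Fr /bounded_measurable_integrable Fi].
move=> [/bounded_measurable_integrable Hr /bounded_measurable_integrable Hi].
rewrite /cE -[RHS]/(_ +i* _); congr (_ +i* _).
  by under eq_Rintegral do rewrite raddfD; rewrite RintegralD.
by under eq_Rintegral do rewrite raddfD; rewrite RintegralD.
Qed.

Lemma cEZl (c : C) F : cbounded_measurable F ->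
  cE (fun x => c * F x) = c * cE F.
Proof.
move=> [mr mi].
have iM (r : R) f : bounded_measurable f ->
    mu.-integrable setT (EFin \o (fun x => r * f x)).
  by move=> mf; apply: bounded_measurable_integrable; apply: bounded_measurableM => //;
     exact: bounded_measurable_cst.
have iM' := bounded_measurable_integrable.
case: c => a b; rewrite /cE -[RHS]/(_ +i* _); congr (_ +i* _).
  under eq_Rintegral do rewrite ReM.
  by rewrite RintegralB ?RintegralZl//; first [exact: iM | exact: iM'].
under eq_Rintegral do rewrite ImM.
by rewrite RintegralD ?RintegralZl//; first [exact: iM | exact: iM'].
Qed.

Lemma cEZr (c : C) F : cbounded_measurable F ->
  cE (fun x => F x * c) = cE F * c.
Proof. by move=> mF; rewrite mulrC -cEZl//; apply: eq_cE => x; rewrite mulrC. Qed.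

Lemma cE_sum (I : Type) (s : seq I) (p : pred I) (F : I -> T -> C) :
  (forall i, cbounded_measurable (F i)) ->
  cE (fun x => \sum_(i <- s | p i) F i x) = \sum_(i <- s | p i) cE (F i).
Proof.
move=> mF; elim: s => [|i s IH].
  by rewrite big_nil -[RHS]cE_cst; apply: eq_cE => x; rewrite big_nil.
rewrite big_cons -IH; case: ifPn => pi.
  rewrite -cED//; first by apply: eq_cE => x; rewrite big_cons pi.
  exact: cbounded_measurable_sum.
by apply: eq_cE => x; rewrite big_cons (negbTE pi).
Qed.

(** The bridge from the real expectation of the statement to complex computations; exhibiting a real
    [e] also records that the expectation is finite. *)
Lemma expectation_cE f : bounded_measurable f ->
  exists2 e : R, 'E_mu[f]%E = e%:E & e%:C = cE (fun x => (f x)%:C).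
Proof.
move=> mf; exists (\int[mu]_x f x).
  rewrite unlock /Rintegral fineK//.
  exact/integrable_fin_num/bounded_measurable_integrable.
by rewrite /cE /= Rintegral_cst// mul0r.
Qed.

(** A non-negative function with zero integral vanishes almost everywhere, so strict positivity
    would make the whole space null, against total mass 1. Positivity in [R[i]] forces the value to
    be real, so only the real part matters. *)
Lemma cE_gt0_neq0 F : cbounded_measurable F ->
  (forall x, 0 < F x) -> cE F != 0.
Proof.
move=> [mF _] F0; apply/eqP => -[+ _].
have F0' x : 0 < complex.Re (F x) by have := F0 x; rewrite ltcE => /andP[].
rewrite /Rintegral => fi0.
have fin : (\int[mu]_x (complex.Re (F x))%:E)%E \is a fin_num.
  exact/integrable_fin_num/bounded_measurable_integrable.
have : (\int[mu]_x `|(complex.Re (F x))%:E|)%E = 0%E.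
  rewrite -[0%E]/(0%:E) -fi0 fineK//; apply: eq_integral => x _.
  by rewrite gee0_abs// lee_fin ltW.
move/(ae_eq_integral_abs mu measurableT).
case; first by apply/measurable_EFinP; case: mF.
move=> N [mN N0 sN]; have : mu setT = 0%E.
  apply: (subset_measure0 measurableT mN _ N0) => x _; apply: sN => /= /(_ I).
  by move=> -[/eqP]; rewrite gt_eqF.
by rewrite probability_setT => /eqP; rewrite onee_eq0.
Qed.

End ComplexExpectation.

(** * Change of variables and expectations of independent products *)

Section ChangeOfVariables.
Context {R : realType} {d : measure_display} {T : measurableType d}
  {d' : measure_display} {T' : measurableType d'}.

(** Serves twice: with [X] a translation of the group it is Haar invariance, with [X] a random
    element it replaces the sample space by the law. *)
Lemma cE_comp (P : probability T R) (mu : probability T' R) (X : T -> T')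
    (F : T' -> R[i]) :
  measurable_fun setT X ->
  (forall A, measurable A -> P (X @^-1` A) = mu A) ->
  cbounded_measurable F -> cE P (F \o X) = cE mu F.
Proof.
move=> mX law [Fr Fi].
have key f : bounded_measurable f ->
    \int[P]_x (f (X x)) = \int[mu]_x f x.
  move=> mf; congr fine.
  rewrite -[LHS]/(\int[P]_(x in X @^-1` setT) ((EFin \o f) \o X) x)%E.
  rewrite -(integral_pushforward mX)//.
  - apply: eq_measure_integral => A mA _; exact: law.
  - by apply/measurable_EFinP; case: mf.
  - exact/bounded_measurable_integrable/(bounded_measurable_comp mX mf).
by rewrite /cE /comp (key _ Fr) (key _ Fi).
Qed.

End ChangeOfVariables.

Section Independence.
Context {R : realType} {d : measure_display} {Omega : measurableType d}
  {d1 : measure_display} {T1 : measurableType d1}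
  {d2 : measure_display} {T2 : measurableType d2}
  (P : probability Omega R) (X : {RV P >-> T1}) (Y : {RV P >-> T2}).
Hypothesis indep : independent_RV P X Y.

Let mX : measurable_fun setT X. Proof. exact: measurable_funPT. Qed.
Let mY : measurable_fun setT Y. Proof. exact: measurable_funPT. Qed.

Let Z w := (X w, Y w).
Let mZ : measurable_fun setT Z. Proof. exact: measurable_fun_pair. Qed.

(** Independence fixes the law of the pair on measurable rectangles, and these determine a product
    of probability measures. *)
Let product_law (A : set (T1 * T2)) : measurable A ->
  (distribution P X \x distribution P Y)%E A = pushforward P Z A.
Proof.
apply: (@product_measure_unique _ _ _ _ _ _ _ (pushforward P Z)).
by move=> B B' mB mB'; exact: indep.
Qed.

Lemma Rintegral_indep (f : T1 -> R) (h : T2 -> R) :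
  bounded_measurable f -> bounded_measurable h ->
  \int[P]_w (f (X w) * h (Y w)) = \int[P]_w (f (X w)) * \int[P]_w (h (Y w)).
Proof.
move=> bf bh; have [mf [M hM]] := bf; have [mh [N hN]] := bh.
pose k (z : T1 * T2) := f z.1 * h z.2.
have bk : bounded_measurable k.
  by apply: bounded_measurableM; [apply: (bounded_measurable_comp measurable_fst bf)|
     apply: (bounded_measurable_comp measurable_snd bh)].
have law d' (T' : measurableType d') (f' : T' -> R) (X' : {RV P >-> T'}) :
    bounded_measurable f' ->
    \int[P]_w (f' (X' w)) = \int[distribution P X']_x f' x.
  move=> bf'; congr fine; rewrite integral_distribution//.
    by apply/measurable_EFinP; case: bf'.
  apply/bounded_measurable_integrable/(bounded_measurable_comp _ bf').
  exact: measurable_funPT.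
rewrite (law _ _ _ X)// (law _ _ _ Y)//.
rewrite -RintegralZr//; last exact: bounded_measurable_integrable.
rewrite /Rintegral; congr fine.
transitivity (\int[pushforward P Z]_z (EFin \o k) z)%E.
  rewrite (integral_pushforward mZ)//; first by apply/measurable_EFinP; case: bk.
  exact/bounded_measurable_integrable/(bounded_measurable_comp mZ bk).
transitivity (\int[distribution P X \x distribution P Y]_z (EFin \o k) z)%E.
  by apply: eq_measure_integral => A mA _; exact/esym/product_law.
(* Fubini: for fixed [x] the inner integral is [f x] times the mean of [h]; what remains is
   integrability of [k] for the product law. *)
rewrite -integral12_prod_meas1.
  apply: eq_integral => x _.
  transitivity (\int[distribution P Y]_y ((f x)%:E * (h y)%:E))%E.
    by apply: eq_integral => y _; rewrite -EFinM.
  rewrite integralZl//; last exact: bounded_measurable_integrable.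
  rewrite EFinM; congr (_ * _)%E; rewrite fineK//.
  exact/integrable_fin_num/bounded_measurable_integrable.
apply: measurable_bounded_integrable => //.
- have PZ1 := etrans (product_law measurableT) (probability_setT P).
  by apply: le_lt_trans (ltry 1); rewrite le_eqVlt; apply/orP; left;
     apply/eqP; exact: PZ1.
- by case: bk.
- case: bk => _ [M' hM']; exists M'; split; first exact: num_real.
  by move=> N' MN x _ /=; rewrite (le_trans (hM' x))// ltW.
Qed.

Lemma cE_indep (F : T1 -> R[i]) (H : T2 -> R[i]) :
  cbounded_measurable F -> cbounded_measurable H ->
  cE P (fun w => F (X w) * H (Y w)) = cE P (F \o X) * cE P (H \o Y).
Proof.
move=> [Fr Fi] [Hr Hi].
have FX := (bounded_measurable_comp mX Fr, bounded_measurable_comp mX Fi).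
have HY := (bounded_measurable_comp mY Hr, bounded_measurable_comp mY Hi).
have iM f g : bounded_measurable f -> bounded_measurable g ->
    P.-integrable setT (EFin \o (fun x => f x * g x)).
  by move=> bf bg; exact/bounded_measurable_integrable/bounded_measurableM.
rewrite /cE -[RHS]/(_ +i* _); congr (_ +i* _).
  under eq_Rintegral do rewrite ReM.
  rewrite RintegralB//; last 2 first.
  - exact: (iM _ _ FX.1 HY.1).
  - exact: (iM _ _ FX.2 HY.2).
  by congr (_ - _); [exact: (Rintegral_indep Fr Hr) |
    exact: (Rintegral_indep Fi Hi)].
under eq_Rintegral do rewrite ImM.
rewrite RintegralD//; last 2 first.
- exact: (iM _ _ FX.1 HY.2).
- exact: (iM _ _ FX.2 HY.1).
by congr (_ + _); [exact: (Rintegral_indep Fr Hi) |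
  exact: (Rintegral_indep Fi Hr)].
Qed.

End Independence.

(** * Continuous functions on a compact group are bounded and Borel *)

Section CompactGroup.
Context {R : realType} {G : topologicalGroupType}.
Hypothesis compactG : compact [set: G].
Local Notation C := R[i].

Lemma continuous_borel_measurable (f : G -> G) : continuous f ->
  measurable_fun setT (f : borelType G -> borelType G).
Proof.
move=> cf; apply: (@measurability _ _ (borelType G) (borelType G)
  setT f (@open G)) => //.
move=> _ [A oA <-].
rewrite setTI; apply: sub_sigma_algebra.
by apply: open_comp => // x _; exact: cf.
Qed.

Lemma continuous_bounded_measurable (f : G -> R) : continuous f ->
  bounded_measurable (f : borelType G -> R).
Proof.
move=> cf; split.
  apply: (measurability _ (RGenOpens.measurableE R)) => // _ [_ [a [b ->]] <-].
  rewrite setTI; apply: sub_sigma_algebra.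
  by apply: open_comp; [move=> x _; exact: cf | exact: interval_open].
have : compact (f @` [set: G]).
  by apply: continuous_compact => //; exact: continuous_subspaceT.
(* Boundedness is given for every number strictly above [M], hence [M + 1]. *)
move=> /compact_bounded[M [_ hM]]; exists (M + 1) => x.
by apply: (hM (M + 1)); [rewrite ltrDl | exists x].
Qed.

Lemma ccontinuous_bounded_measurable (F : G -> C) : ccontinuous F ->
  cbounded_measurable (F : borelType G -> C).
Proof. by move=> [Fr Fi]; split; exact: continuous_bounded_measurable. Qed.

End CompactGroup.

(** * Schur's lemma and direct sums of representations *)

Section MatrixFacts.
Context {F : fieldType}.

Lemma mulmx_cV_inj m n (A B : 'M[F]_(m, n)) :
  (forall u : 'cV_n, A *m u = B *m u) -> A = B.
Proof.
move=> h; apply/matrixP => i j.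
by have := h (delta_mx j 0); rewrite -!colE => /matrixP/(_ i 0); rewrite !mxE.
Qed.

(** Irreducibility is phrased with subspaces, so inverses and projectors arise as abstract linear
    maps; this brings them back to matrices, whose columns are the images of the standard basis. *)
Lemma lfun_cV_mulmx m n (f : 'Hom('cV[F]_n, 'cV[F]_m)) :
  exists (B : 'M[F]_(m, n)), forall u, f u = B *m u.
Proof.
exists (\matrix_(i, j) f (delta_mx j 0) i 0) => u.
rewrite {1}[u]matrix_sum_delta exchange_big big_ord1 linear_sum /=.
apply/colP => i; rewrite summxE mxE; apply: eq_bigr => j _.
by rewrite linearZ !mxE mulrC.
Qed.

Lemma bij_mulmx_inverse m n (A : 'M[F]_(m, n)) :
  let f : 'Hom('cV_n, 'cV_m) := linfun (mulmx A) in
  lker f = 0%VS -> limg f = fullv ->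
  exists B : 'M[F]_(n, m), A *m B = 1%:M /\ B *m A = 1%:M.
Proof.
move=> f ker0 imgT; have [B hB] := lfun_cV_mulmx (f^-1)%VF.
exists B; split; apply: mulmx_cV_inj => u; rewrite mul1mx -mulmxA.
  by rewrite -hB -[LHS]lfunE limg_lfunVK// imgT memvf.
by rewrite -hB -[A *m u]lfunE lker0_lfunK// ker0.
Qed.

End MatrixFacts.

Section CContinuity.
Context {R : realType} {T : topologicalType}.
Implicit Types f g : T -> R[i].

Lemma ccontinuousD f g :
  ccontinuous f -> ccontinuous g -> ccontinuous (fun x => f x + g x).
Proof.
move=> [fr fi] [gr gi]; split=> x.
  rewrite (_ : (fun y => _) = fun y => complex.Re (f y) + complex.Re (g y)).
    by apply: cvgD; [exact: fr|exact: gr].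
  by apply/funext => y; rewrite raddfD.
rewrite (_ : (fun y => _) = fun y => complex.Im (f y) + complex.Im (g y)).
  by apply: cvgD; [exact: fi|exact: gi].
by apply/funext => y; rewrite raddfD.
Qed.

Lemma ccontinuous_sum (I : Type) (s : seq I) (f : I -> T -> R[i]) :
  (forall i, ccontinuous (f i)) -> ccontinuous (fun x => \sum_(i <- s) f i x).
Proof.
move=> cf; elim: s => [|i s IH].
  by under eq_fun do rewrite big_nil; exact: ccontinuous_cst.
by under eq_fun do rewrite big_cons; exact: ccontinuousD.
Qed.

Lemma ccontinuous_comp (S : topologicalType) f (h : S -> T) :
  continuous h -> ccontinuous f -> ccontinuous (f \o h).
Proof.
move=> ch [fr fi]; split=> x.
  exact: (continuous_comp (ch x) (fr (h x))).
exact: (continuous_comp (ch x) (fi (h x))).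
Qed.

End CContinuity.

Section RepAlgebra.
Context {R : realType} {G : topologicalGroupType}.
Local Notation C := R[i].
Implicit Types phi psi rho : rep R G.

Lemma rep_iso_rdim phi psi : rep_iso phi psi -> rdim phi = rdim psi.
Proof.
move=> [A [B [AB BA _]]]; apply/eqP; rewrite eqn_leq; apply/andP; split.
  rewrite -(mxrank1 C (rdim phi)) -BA.
  by apply: leq_trans (mxrankM_maxl _ _) _; exact: rank_leq_col.
rewrite -(mxrank1 C (rdim psi)) -AB.
by apply: leq_trans (mxrankM_maxl _ _) _; exact: rank_leq_col.
Qed.

Lemma rep_iso_char phi psi : rep_iso phi psi -> rep_char phi =1 rep_char psi.
Proof.
move=> [A [B [AB BA hA]]] x.
by rewrite /rep_char -[phi x]mul1mx -BA -mulmxA hA mxtrace_mulC -mulmxA AB mulmx1.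
Qed.

Lemma rep_char_sum phi psi x :
  rep_char (rep_sum phi psi) x = rep_char phi x + rep_char psi x.
Proof. by rewrite /rep_char mxtrace_block. Qed.

Lemma rep_char_bigsum (s : seq (rep R G)) x :
  rep_char (rep_bigsum s) x = \sum_(phi <- s) rep_char phi x.
Proof.
elim: s => [|phi s IH]; first by rewrite big_nil /rep_char [\tr _]big_ord0.
by rewrite big_cons -IH -rep_char_sum.
Qed.

Lemma rep_char_triv x : rep_char (rep_triv R G) x = 1.
Proof. by rewrite /rep_char mxtrace1. Qed.

Lemma rep_char_tensor_pow (tau : rep R G) r x :
  rep_char (rep_tensor_pow tau r) x = rep_char tau x ^+ r.
Proof.
elim: r => [|r IH]; first by rewrite rep_char_triv.
by rewrite exprS -IH [LHS]mxtrace_prod.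
Qed.

Lemma rep_char_continuous phi : ccontinuous (rep_char phi).
Proof.
by apply: ccontinuous_sum => i; exact: rmx_continuous.
Qed.

(** The kernel and the image of an intertwiner are invariant subspaces; [A != 0] excludes a full
    kernel and a zero image. *)
Lemma schur_invertible phi psi (A : 'M[C]_(rdim psi, rdim phi)) :
  rep_irreducible phi -> rep_irreducible psi ->
  (forall x, A *m phi x = psi x *m A) -> A != 0 ->
  exists B, A *m B = 1%:M /\ B *m A = 1%:M.
Proof.
move=> [_ irr_phi] [_ irr_psi] hA A0.
pose f : 'Hom('cV_(rdim phi), 'cV_(rdim psi)) := linfun (mulmx A).
have fE u : f u = A *m u by rewrite lfunE.
apply: bij_mulmx_inverse.
  have [x u|//|kerT] := irr_phi (lker f).
    by rewrite !memv_ker !fE => /eqP Au0; rewrite mulmxA hA -mulmxA Au0 mulmx0.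
  case/eqP: A0; apply: mulmx_cV_inj => u; rewrite mul0mx -fE; apply/eqP.
  by rewrite -memv_ker kerT memvf.
have [x _ /memv_imgP[u _ ->]|img0|//] := irr_psi (limg f).
  by rewrite fE mulmxA -hA -mulmxA -fE; apply: memv_img; rewrite memvf.
case/eqP: A0; apply: mulmx_cV_inj => u; rewrite mul0mx -fE; apply/eqP.
by rewrite -memv0 -img0 memv_img// memvf.
Qed.

Lemma schur_eq0 phi psi (A : 'M[C]_(rdim psi, rdim phi)) :
  rep_irreducible phi -> rep_irreducible psi ->
  (forall x, A *m phi x = psi x *m A) -> ~ rep_iso phi psi -> A = 0.
Proof.
move=> irr_phi irr_psi hA niso; apply/eqP; apply/negP => /negP A0; apply: niso.
by have [B [AB BA]] := schur_invertible irr_phi irr_psi hA A0; exists A, B.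
Qed.

(** An eigenvalue [a] exists because [R[i]] is algebraically closed and the dimension is positive.
    The intertwiner [A - a%:M] is singular, hence zero, and the trace then identifies [a]. *)
Lemma schur_scalar phi (A : 'M[C]_(rdim phi)) :
  rep_irreducible phi -> (forall x, A *m phi x = phi x *m A) ->
  A = (\tr A / (rdim phi)%:R)%:M.
Proof.
move=> irr hA; have n0 : (0 < rdim phi)%N by case: irr.
have [a] : exists a, root (char_poly A) a.
  by apply/closed_rootP; rewrite size_char_poly; case: (rdim phi) n0.
rewrite -eigenvalue_root_char => /eigenvalueP[v /eqP va v0].
have Aa : A = a%:M.
  apply/eqP; rewrite -subr_eq0; apply/negP => /negP Aa0.
  have [x|B [AB _]] := schur_invertible irr irr _ Aa0.
    by rewrite mulmxBl mulmxBr hA mul_scalar_mx mul_mx_scalar.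
  (* The eigenvector [v] is a row killed by [A - a%:M] on its right, so a right inverse of that
     matrix forces [v = 0]. *)
  case/negP: v0; apply/eqP.
  rewrite -[v]mulmx1 -AB mulmxA mulmxBr (eqP va) mul_mx_scalar subrr.
  by rewrite mul0mx.
rewrite {1}Aa; congr (_%:M); rewrite Aa mxtrace_scalar -[a *+ _]mulr_natr mulfK//.
by rewrite pnatr_eq0 -lt0n.
Qed.

Lemma rep_iso_sum phi phi' psi psi' :
  rep_iso phi phi' -> rep_iso psi psi' ->
  rep_iso (rep_sum phi psi) (rep_sum phi' psi').
Proof.
move=> [A [B [AB BA hA]]] [A' [B' [AB' BA' hA']]].
exists (block_mx A 0 0 A'), (block_mx B 0 0 B'); split=> [||x] /=.
- by rewrite mulmx_block !(mulmx0, mul0mx, addr0, add0r) AB AB' -scalar_mx_block.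
- by rewrite mulmx_block !(mulmx0, mul0mx, addr0, add0r) BA BA' -scalar_mx_block.
- by rewrite !mulmx_block !(mulmx0, mul0mx, addr0, add0r) hA hA'.
Qed.

Lemma rep_iso_zero_sum phi : rep_iso (rep_sum (rep_zero (R:=R) (G:=G)) phi) phi.
Proof.
exists (row_mx 0 1%:M), (col_mx 0 1%:M); split=> [||x] /=.
- by rewrite mul_row_col mulmx0 add0r mulmx1.
- rewrite mul_col_row !(mulmx0, mul0mx) mulmx1.
  apply: etrans _ (esym (scalar_mx_block _ _ _)).
  by congr block_mx; rewrite [RHS]flatmx0.
- by rewrite mul_row_block mul_mx_row !(mulmx0, mul0mx, addr0, add0r, mulmx1, mul1mx).
Qed.

Lemma rep_iso_sum_zero phi : rep_iso (rep_sum phi (rep_zero (R:=R) (G:=G))) phi.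
Proof.
exists (row_mx 1%:M 0), (col_mx 1%:M 0); split=> [||x] /=.
- by rewrite mul_row_col mulmx0 addr0 mulmx1.
- rewrite mul_col_row !(mulmx0, mul0mx) mulmx1.
  apply: etrans _ (esym (scalar_mx_block _ _ _)).
  by congr block_mx; rewrite [RHS]flatmx0.
- by rewrite mul_row_block mul_mx_row !(mulmx0, mul0mx, addr0, add0r, mulmx1, mul1mx).
Qed.

(** The sizes (a + b) + c and a + (b + c) are not convertible, so the intertwiner is the identity
    cut into blocks that fit both bracketings. *)
Lemma rep_iso_sumA phi psi rho :
  rep_iso (rep_sum (rep_sum phi psi) rho) (rep_sum phi (rep_sum psi rho)).
Proof.
exists (col_mx (row_mx (row_mx 1%:M 0) 0)
               (col_mx (row_mx (row_mx 0 1%:M) 0) (row_mx 0 1%:M))).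
exists (row_mx (col_mx (col_mx 1%:M 0) 0)
               (row_mx (col_mx (col_mx 0 1%:M) 0) (col_mx 0 1%:M))).
have simpl0 := (mulmx0, mul0mx, addr0, add0r, mulmx1, mul1mx, @row_mx0, @col_mx0).
split=> [||x] /=.
- rewrite !(mul_col_mx, mul_mx_row, mul_row_col, simpl0).
  rewrite !scalar_mx_block /block_mx; congr col_mx.
  by rewrite -[X in row_mx X (col_mx _ _)]col_mx0 -[RHS]block_mxEh.
- rewrite !(mul_row_col, mul_col_mx, mul_mx_row, simpl0).
  rewrite !(add_col_mx, add_row_mx, simpl0) !scalar_mx_block /block_mx.
  congr col_mx.
  by rewrite -[X in row_mx (col_mx _ _) X]col_mx0 -[RHS]block_mxEh.
- by rewrite /block_mx !(mul_row_col, mul_col_mx, mul_mx_row, simpl0).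
Qed.

Lemma rep_bigsum_cat (s t : seq (rep R G)) :
  rep_iso (rep_bigsum (s ++ t)) (rep_sum (rep_bigsum s) (rep_bigsum t)).
Proof.
elim: s => [|phi s IH] /=; first exact/rep_iso_sym/rep_iso_zero_sum.
apply: rep_iso_trans (rep_iso_sum (rep_iso_refl phi) IH) _.
exact/rep_iso_sym/rep_iso_sumA.
Qed.

End RepAlgebra.

(** * Haar averages, orthogonality and complete reducibility *)

Section MatrixExpectation.
Context {R : realType} {d : measure_display} {T : measurableType d}
  (mu : probability T R).
Local Notation C := R[i].

Definition mbounded_measurable m n (F : T -> 'M[C]_(m, n)) : Prop :=
  forall i j, cbounded_measurable (fun x => F x i j).

Definition mE m n (F : T -> 'M[C]_(m, n)) : 'M[C]_(m, n) :=
  \matrix_(i, j) cE mu (fun x => F x i j).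

Lemma mbounded_measurable_cst m n (A : 'M[C]_(m, n)) :
  mbounded_measurable (fun=> A).
Proof. by move=> i j; exact: cbounded_measurable_cst. Qed.

Lemma mbounded_measurableM m n p (F : T -> 'M[C]_(m, n)) (H : T -> 'M[C]_(n, p)) :
  mbounded_measurable F -> mbounded_measurable H ->
  mbounded_measurable (fun x => F x *m H x).
Proof.
move=> mF mH i j; under eq_fun do rewrite mxE.
by apply: cbounded_measurable_sum => k; exact: cbounded_measurableM.
Qed.

Lemma eq_mE m n (F H : T -> 'M[C]_(m, n)) : F =1 H -> mE F = mE H.
Proof. by move=> /funext ->. Qed.

Lemma mE_cst m n (A : 'M[C]_(m, n)) : mE (fun=> A) = A.
Proof. by apply/matrixP => i j; rewrite mxE cE_cst. Qed.

Lemma mE_mull m n p (A : 'M[C]_(p, m)) (F : T -> 'M[C]_(m, n)) :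
  mbounded_measurable F -> mE (fun x => A *m F x) = A *m mE F.
Proof.
move=> mF; apply/matrixP => i j; rewrite !mxE.
under eq_cE do rewrite mxE.
rewrite cE_sum; last first.
  by move=> k; apply: cbounded_measurableM => //; exact: cbounded_measurable_cst.
by apply: eq_bigr => k _; rewrite cEZl// mxE.
Qed.

Lemma mE_mulr m n p (A : 'M[C]_(n, p)) (F : T -> 'M[C]_(m, n)) :
  mbounded_measurable F -> mE (fun x => F x *m A) = mE F *m A.
Proof.
move=> mF; apply/matrixP => i j; rewrite !mxE.
under eq_cE do rewrite mxE.
rewrite cE_sum; last first.
  by move=> k; apply: cbounded_measurableM => //; exact: cbounded_measurable_cst.
by apply: eq_bigr => k _; rewrite cEZr// mxE.
Qed.

Lemma mxtrace_mE n (F : T -> 'M[C]_n) :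
  mbounded_measurable F -> \tr (mE F) = cE mu (fun x => \tr (F x)).
Proof. by move=> mF; rewrite cE_sum//; apply: eq_bigr => i _; rewrite mxE. Qed.

End MatrixExpectation.

Lemma mul_delta_mx_entry (F : fieldType) m n p q (A : 'M[F]_(m, n))
    (B : 'M[F]_(p, q)) i j k l :
  (A *m delta_mx j k *m B) i l = A i j * B k l.
Proof.
rewrite mxE (bigD1 k)//= big1 ?addr0 => [|k' k'k]; rewrite mxE (bigD1 j)//= big1.
- by rewrite mxE !eqxx mulr1 addr0.
- by move=> j' j'j; rewrite mxE (negbTE j'j) mulr0.
- by rewrite mxE (negbTE k'k) andbF mulr0 addr0 mul0r.
- by move=> j' j'j; rewrite mxE (negbTE j'j) mulr0.
Qed.

Lemma mxtrace_delta (F : fieldType) n (i k : 'I_n) :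
  \tr (delta_mx i k : 'M[F]_n) = (i == k)%:R.
Proof.
rewrite /mxtrace (bigD1 i)//= big1 => [|j ji]; first by rewrite mxE eqxx addr0.
by rewrite mxE (negbTE ji).
Qed.

(** With the rank factorization P = C R, the equation C R C R = C R can be cancelled by C on the
    left and by R on the right. *)
Lemma idempotent_base (F : fieldType) n (P : 'M[F]_n) :
  P *m P = P -> row_base P *m col_base P = 1%:M.
Proof.
move=> PP; apply: (row_full_inj (col_base_full P)).
apply: (row_free_inj (row_base_free P)).
by rewrite mulmxA mulmx_base -mulmxA mulmx_base mulmx1 mulmx_base.
Qed.

(** Rank factorizations of the complementary idempotents P and 1 - P give coordinates on their
    images. The last clause is what later makes both summands non-zero. *)
Lemma idempotent_split (F : fieldType) n (P : 'M[F]_n) : P *m P = P ->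
  exists r1 r2 (A1 : 'M[F]_(n, r1)) (B1 : 'M[F]_(r1, n))
    (A2 : 'M[F]_(n, r2)) (B2 : 'M[F]_(r2, n)),
  [/\ B1 *m A1 = 1%:M /\ B2 *m A2 = 1%:M, B1 *m A2 = 0 /\ B2 *m A1 = 0,
      A1 *m B1 = P /\ A2 *m B2 = 1%:M - P &
      (r1 == 0%N) = (P == 0) /\ (r2 == 0%N) = (P == 1%:M)].
Proof.
move=> PP; set Q := 1%:M - P.
have PQ : P *m Q = 0 by rewrite mulmxBr mulmx1 PP subrr.
have QP : Q *m P = 0 by rewrite mulmxBl mul1mx PP subrr.
have QQ : Q *m Q = Q by rewrite {1}/Q mulmxBl PQ subr0 mul1mx.
have rowE (S : 'M[F]_n) : S *m S = S -> row_base S *m S = row_base S.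
  by move=> SS; rewrite -[X in _ *m X]mulmx_base mulmxA idempotent_base// mul1mx.
have colE (S : 'M[F]_n) : S *m S = S -> S *m col_base S = col_base S.
  by move=> SS; rewrite -[X in X *m _]mulmx_base -mulmxA idempotent_base// mulmx1.
have base0 (S S' : 'M[F]_n) : S *m S = S -> S' *m S' = S' -> S *m S' = 0 ->
    row_base S *m col_base S' = 0.
  move=> SS SS' SS0; rewrite -(rowE S SS) -(colE S' SS') mulmxA -(mulmxA _ S S').
  by rewrite SS0 mulmx0 mul0mx.
exists (\rank P), (\rank Q), (col_base P), (row_base P), (col_base Q), (row_base Q).
split; split; rewrite ?mulmx_base ?idempotent_base ?base0 ?mxrank_eq0//.
by rewrite subr_eq0 eq_sym.
Qed.

(** * Subrepresentations cut out by commuting idempotents *)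

Section Splitting.
Context {R : realType} {G : topologicalGroupType}.
Local Notation C := R[i].
Implicit Types phi : rep R G.

(** The subrepresentation on the image of the idempotent [A *m B], in coordinates: [A] embeds and
    [B] projects. Multiplicativity comes from [comm]. *)
Program Definition rep_compress phi r (A : 'M[C]_(rdim phi, r))
    (B : 'M[C]_(r, rdim phi)) (BA : B *m A = 1%:M)
    (comm : forall x, A *m B *m phi x = phi x *m (A *m B)) : rep R G :=
  @Rep _ _ r (fun x => B *m phi x *m A) _ _ _.
Next Obligation. by move=> phi r A B BA _ /=; rewrite rmx1 mulmx1. Qed.
Next Obligation.
move=> phi r A B BA comm x y /=.
have -> : B *m phi x *m A *m (B *m phi y *m A) =
    B *m phi x *m (A *m B *m phi y) *m A by rewrite !mulmxA.
by rewrite comm rmxM -!mulmxA BA mulmx1.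
Qed.
Next Obligation.
move=> phi r A B BA comm i j /=; under eq_fun do rewrite mxE.
apply: ccontinuous_sum => k; apply: ccontinuousM; last exact: ccontinuous_cst.
under eq_fun do rewrite mxE.
apply: ccontinuous_sum => l; apply: ccontinuousM; first exact: ccontinuous_cst.
exact: rmx_continuous.
Qed.

Lemma rep_split_idempotent phi (P : 'M[C]_(rdim phi)) :
  P *m P = P -> (forall x, P *m phi x = phi x *m P) ->
  exists phi1 phi2, [/\ rep_iso phi (rep_sum phi1 phi2),
    (rdim phi1 == 0%N) = (P == 0) & (rdim phi2 == 0%N) = (P == 1%:M)].
Proof.
move=> PP comm.
have [r1 [r2 [A1 [B1 [A2 [B2 [[BA1 BA2] [BA12 BA21] [AB1 AB2] [r10 r20]]]]]]]] :=
  idempotent_split PP.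
have c1 x : A1 *m B1 *m phi x = phi x *m (A1 *m B1) by rewrite AB1.
have c2 x : A2 *m B2 *m phi x = phi x *m (A2 *m B2).
  by rewrite AB2 mulmxBl mulmxBr mulmx1 mul1mx comm.
exists (rep_compress BA1 c1), (rep_compress BA2 c2); split=> //.
exists (col_mx B1 B2), (row_mx A1 A2).
split=> [||x] /=.
- by rewrite mul_col_row BA1 BA2 BA12 BA21 -scalar_mx_block.
- by rewrite mul_row_col AB1 AB2 addrC subrK.
- rewrite mul_col_mx mul_block_col !mul0mx addr0 add0r.
  by rewrite -!(mulmxA (_ *m phi x)) -!(mulmxA _ (phi x)) -c1 -c2 !mulmxA
    BA1 BA2 !mul1mx.
Qed.

End Splitting.

(** * Intertwiners obtained by averaging over Haar measure *)

Section HaarAverage.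
Context {R : realType} {G : topologicalGroupType}.
Hypothesis compactG : compact [set: G].
Variable mu : probability (borelType G) R.
Hypothesis haar_mu : is_haar mu.
Local Notation C := R[i].
Implicit Types phi psi rho : rep R G.

Let bm (F : G -> C) := cbounded_measurable (F : borelType G -> C).

Lemma continuous_mulg (f h : G -> G) : continuous f -> continuous h ->
  continuous (fun x => f x * h x)%g.
Proof.
move=> cf ch x.
apply: (@continuous_comp _ _ _ (fun x => (f x, h x)) (fun xy => xy.1 * xy.2)%g).
  by apply: cvg_pair; [exact: cf | exact: ch].
exact: (@mulg_continuous G).
Qed.

Lemma mulg_left_continuous (g : G) : continuous (fun x : G => g * x)%g.
Proof. by apply: continuous_mulg => x; [exact: cvg_cst | exact: cvg_id]. Qed.

Lemma conjg_continuous (a : G) : continuous (fun h : G => h * a * h^-1)%g.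
Proof.
apply: continuous_mulg; last exact: invg_continuous.
by apply: continuous_mulg => x; [exact: cvg_id | exact: cvg_cst].
Qed.

Lemma cE_haar (g : G) (F : G -> C) : bm F ->
  cE mu (fun x : G => F (g * x)%g) = cE mu F.
Proof.
move=> mF; apply: (@cE_comp _ _ _ _ _ mu mu (fun x : G => (g * x)%g)) => //.
  exact: (continuous_borel_measurable (@mulg_left_continuous g)).
by move=> A mA; exact: haar_mu.
Qed.

Lemma mE_haar (g : G) m n (F : G -> 'M[C]_(m, n)) :
  mbounded_measurable (F : borelType G -> _) ->
  mE mu (fun x : G => F (g * x)%g) = mE mu F.
Proof.
by move=> mF; apply/matrixP => i j; rewrite !mxE (cE_haar g (mF i j)).
Qed.

Lemma rep_bounded_measurable phi : mbounded_measurable (phi : borelType G -> _).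
Proof.
by move=> i j; apply: ccontinuous_bounded_measurable => //; exact: rmx_continuous.
Qed.

Lemma repV_bounded_measurable phi :
  mbounded_measurable (fun x : borelType G => phi (x : G)^-1%g).
Proof.
move=> i j; apply: (@ccontinuous_bounded_measurable _ _ _ 
  (fun x => phi x^-1%g i j)) => //.
apply: (@ccontinuous_comp _ _ _ (fun x => phi x i j)); first exact: invg_continuous.
exact: rmx_continuous.
Qed.

Lemma rep_char_bounded_measurable phi : bm (rep_char phi).
Proof. by apply: ccontinuous_bounded_measurable => //; exact: rep_char_continuous. Qed.

(** Makes an intertwiner from [psi] to [phi] out of any matrix. Elementary matrices give the
    orthogonality relations, [phi a] gives the average over a conjugacy class, and a projector gives
    an invariant complement. *)
Definition rep_avg phi psi (B : 'M[C]_(rdim phi, rdim psi)) :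
    'M[C]_(rdim phi, rdim psi) :=
  mE mu (fun x : G => phi x *m B *m psi x^-1%g).

Lemma rep_avg_bounded_measurable phi psi B :
  mbounded_measurable (fun x : borelType G => phi x *m B *m psi (x : G)^-1%g).
Proof.
apply: mbounded_measurableM; last exact: repV_bounded_measurable.
apply: mbounded_measurableM; last exact: mbounded_measurable_cst.
exact: rep_bounded_measurable.
Qed.

(** Left invariance allows [g * x] in place of [x]: then [phi g] comes out on the left, and psi(x^-1
    g^-1) psi(g) collapses to psi(x^-1). *)
Lemma rep_avg_intertwines phi psi B g :
  rep_avg B *m psi g = phi g *m @rep_avg phi psi B.
Proof.
have bB := @rep_avg_bounded_measurable phi psi B.
rewrite /rep_avg -[X in X *m _](mE_haar g bB) -mE_mulr; last first.
  move=> i j.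
  apply: (cbounded_measurable_comp _ (bB i j)).
  exact: (continuous_borel_measurable (@mulg_left_continuous g)).
rewrite -mE_mull//; apply: eq_mE => x.
by rewrite invgM rmxM -!mulmxA -rmxM mulgVK.
Qed.

Lemma mxtrace_rep_avg phi (B : 'M[C]_(rdim phi)) : \tr (rep_avg B) = \tr B.
Proof.
rewrite mxtrace_mE; last exact: rep_avg_bounded_measurable.
rewrite -[RHS](cE_cst mu); apply: eq_cE => x.
by rewrite mxtrace_mulC mulmxA -rmxM mulVg rmx1 mul1mx.
Qed.

Lemma rep_avg_delta phi psi i j k l :
  @rep_avg phi psi (delta_mx j k) i l =
  cE mu (fun x : G => phi x i j * psi x^-1%g k l).
Proof. by rewrite mxE; apply: eq_cE => x; rewrite mul_delta_mx_entry. Qed.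

Lemma cE_char_prod phi psi :
  cE mu (fun x : G => rep_char phi x * rep_char psi x^-1%g) =
  \sum_i \sum_k @rep_avg phi psi (delta_mx i k) i k.
Proof.
under [RHS]eq_bigr do under eq_bigr do rewrite rep_avg_delta.
under [LHS]eq_cE do rewrite big_distrlr.
have bm_ik i k : bm (fun x => phi x i i * psi x^-1%g k k).
  apply: (@cbounded_measurableM _ _ (borelType G)).
    exact: rep_bounded_measurable.
  exact: repV_bounded_measurable.
rewrite cE_sum => [|i]; last by apply: cbounded_measurable_sum => k; exact: bm_ik.
by apply: eq_bigr => i _; rewrite cE_sum// => k; exact: bm_ik.
Qed.

(** Taking the second character at [x^-1] instead of conjugating it keeps unitarity out of the
    argument. Without isomorphism all averaged intertwiners vanish; otherwise the average of the
    elementary matrix (i, k) is the scalar delta_ik / n, and the n diagonal terms 1/n add up to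
    1. *)
Lemma irr_char_orthonormal phi psi :
  rep_irreducible phi -> rep_irreducible psi ->
  cE mu (fun x : G => rep_char phi x * rep_char psi x^-1%g) =
  `[< rep_iso phi psi >]%:R.
Proof.
move=> irr_phi irr_psi; case: asboolP => [iso|niso]; last first.
  rewrite cE_char_prod big1// => i _; rewrite big1// => k _.
  rewrite (@schur_eq0 _ _ psi phi (rep_avg _)) ?mxE// => [x|/rep_iso_sym//].
  exact: rep_avg_intertwines.
under eq_cE do rewrite -(rep_iso_char iso).
have n0 : (rdim phi)%:R != 0 :> C by rewrite pnatr_eq0 -lt0n; case: irr_phi.
rewrite cE_char_prod (eq_bigr (fun=> (rdim phi)%:R^-1)) => [|i _].
  by rewrite sumr_const card_ord -[LHS]mulr_natr mulVf.
have avgE k : rep_avg (delta_mx i k) =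
    ((i == k)%:R / (rdim phi)%:R)%:M :> 'M[C]_(rdim phi).
  rewrite (schur_scalar irr_phi (rep_avg_intertwines _)).
  by rewrite mxtrace_rep_avg mxtrace_delta.
rewrite (bigD1 i)//= avgE mxE eqxx mul1r mulr1n big1 ?addr0// => k ki.
by rewrite avgE mxE eq_sym (negbTE ki) mulr0n.
Qed.

Lemma mE_rep_conj phi (a : G) : rep_irreducible phi ->
  mE mu (fun h : G => phi (h * a * h^-1)%g) =
  (rep_char phi a / (rdim phi)%:R)%:M.
Proof.
move=> irr; under eq_mE do rewrite !rmxM.
rewrite [LHS](schur_scalar irr (rep_avg_intertwines (phi a))).
by rewrite mxtrace_rep_avg.
Qed.

(* The average of a projector onto an invariant subspace U is an intertwining
   idempotent with the same image U. *)
Lemma reducible_split phi : (0 < rdim phi)%N -> ~ rep_irreducible phi ->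
  exists phi1 phi2, [/\ rep_iso phi (rep_sum phi1 phi2),
    (rdim phi1 < rdim phi)%N & (rdim phi2 < rdim phi)%N].
Proof.
move=> n0 /not_andP[//|/existsNP[U /not_implyP[stU /not_orP[U0 UT]]]].
have [P0 P0E] := lfun_cV_mulmx (projv U).
have P0U u : P0 *m u \in U by rewrite -P0E memv_proj.
have P0id u : u \in U -> P0 *m u = u by move=> uU; rewrite -P0E projv_id.
have P0phi x : P0 *m phi x *m P0 = phi x *m P0.
  apply: mulmx_cV_inj => u; rewrite -2!mulmxA P0id ?mulmxA//.
  by rewrite -mulmxA stU.
have P0P0 : P0 *m P0 = P0 by have := P0phi 1%g; rewrite rmx1 mulmx1 mul1mx.
pose P := @rep_avg phi phi P0.
have bP := @rep_avg_bounded_measurable phi phi P0.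
have P0P : P0 *m P = P.
  by rewrite -mE_mull//; apply: eq_mE => x; rewrite !mulmxA P0phi.
have PP0 : P *m P0 = P0.
  rewrite -mE_mulr// -[RHS](mE_cst mu); apply: eq_mE => x.
  have -> : phi x *m P0 *m phi x^-1%g *m P0 = phi x *m (P0 *m phi x^-1%g *m P0).
    by rewrite !mulmxA.
  by rewrite P0phi mulmxA -rmxM mulgV rmx1 mul1mx.
have PP : P *m P = P by rewrite -{2}P0P mulmxA PP0 P0P.
have P_neq0 : P != 0.
  apply/eqP => P_0; apply: U0; apply/eqP; rewrite -subv0; apply/subvP => u uU.
  by rewrite -(P0id _ uU) -PP0 P_0 !mul0mx mem0v.
have P_neq1 : P != 1%:M.
  apply/eqP => P_1; apply: UT; apply/eqP; rewrite eqEsubv subvf /=.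
  by apply/subvP => u _; rewrite -[u]mul1mx -P_1 -P0P P_1 mulmx1 P0U.
have [phi1 [phi2 [iso r1 r2]]] := rep_split_idempotent PP (rep_avg_intertwines P0).
exists phi1, phi2; split=> //; rewrite (rep_iso_rdim iso) /=.
  by rewrite -[ltnLHS]addn0 ltn_add2l lt0n r2.
by rewrite -[ltnLHS]add0n ltn_add2r lt0n r1.
Qed.

(** Strong induction on the dimension. A zero-dimensional representation is not irreducible by
    definition, so it has to be the empty sum. *)
Lemma rep_complete_reducible rho :
  exists2 s : seq (rep R G), (forall phi, phi \in s -> rep_irreducible phi) &
    rep_iso rho (rep_bigsum s).
Proof.
move: {2}(rdim rho).+1 (ltnSn (rdim rho)) => n; elim: n rho => // n IH rho.
rewrite ltnS => rho_n; have [rho0|rho0] := posnP (rdim rho).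
  exists [::] => //=; exists 0, 0; split=> [||x].
  - by apply/matrixP => -[].
  - by apply/matrixP => i j; have := ltn_ord i; rewrite {2}rho0.
  - by apply/matrixP => -[].
have [irr|/(reducible_split rho0)[rho1 [rho2 [iso lt1 lt2]]]] :=
  pselect (rep_irreducible rho).
  exists [:: rho] => [phi|]; first by rewrite inE => /eqP ->.
  exact/rep_iso_sym/rep_iso_sum_zero.
have [s1 irr1 iso1] := IH _ (leq_trans lt1 rho_n).
have [s2 irr2 iso2] := IH _ (leq_trans lt2 rho_n).
exists (s1 ++ s2) => [phi|]; first by rewrite mem_cat => /orP[/irr1|/irr2].
apply: rep_iso_trans iso _; apply: rep_iso_trans (rep_iso_sum iso1 iso2) _.
exact/rep_iso_sym/rep_bigsum_cat.
Qed.

End HaarAverage.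

(** * Invariant Hermitian forms and characters at inverses *)

Section Adjoint.
Context {R : realType}.
Local Notation C := R[i].

Definition adjmx m n (A : 'M[C]_(m, n)) : 'M[C]_(n, m) := map_mx conjc A^T.

Lemma adjmxM m n p (A : 'M[C]_(m, n)) (B : 'M[C]_(n, p)) :
  adjmx (A *m B) = adjmx B *m adjmx A.
Proof. by rewrite /adjmx trmx_mul map_mxM. Qed.

Lemma mxtrace_adjmx n (A : 'M[C]_n) : \tr (adjmx A) = conjc (\tr A).
Proof. by rewrite /mxtrace raddf_sum; apply: eq_bigr => i _; rewrite !mxE. Qed.

Lemma adjmx_mul_gt0 n (u : 'cV[C]_n) : u != 0 -> 0 < (adjmx u *m u) 0 0.
Proof.
move=> u0; rewrite mxE.
have ge0 i : 0 <= adjmx u 0 i * u i 0 by rewrite !mxE mulrC mulcJ_ge0.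
rewrite lt_def sumr_ge0// andbT; apply: contra u0 => /eqP s0.
apply/eqP/matrixP => i j; rewrite ord1 mxE.
have /eqP := psumr_eq0P (fun i _ => ge0 i) s0 (i := i) isT.
by rewrite !mxE mulf_eq0 conjc_eq0 orbb => /eqP.
Qed.

(** [kermx] is the kernel on row vectors, hence the passage to the transpose. *)
Lemma cV_ker0_unitmx n (A : 'M[C]_n) :
  (forall u : 'cV_n, A *m u = 0 -> u = 0) -> A \in unitmx.
Proof.
move=> ker0; rewrite -unitmx_tr -row_free_unit -kermx_eq0; apply/rowV0P => v.
move=> /sub_kermxP vA; apply: trmx_inj; rewrite trmx0; apply: ker0.
by rewrite -[A]trmxK -trmx_mul vA trmx0.
Qed.

End Adjoint.

Section UnitaryTrick.
Context {R : realType} {G : topologicalGroupType}.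
Hypothesis compactG : compact [set: G].
Variable mu : probability (borelType G) R.
Hypothesis haar_mu : is_haar mu.
Local Notation C := R[i].

(* The average H of the Gram matrices phi(x^-1)^* phi(x^-1) is an invertible
   invariant Hermitian form, so H conjugates phi(x) into phi(x^-1)^*. *)
Lemma rep_charV (phi : rep R G) (g : G) :
  rep_char phi g^-1%g = conjc (rep_char phi g).
Proof.
pose F (x : borelType G) := adjmx (phi (x : G)^-1%g) *m phi (x : G)^-1%g.
have bV := @repV_bounded_measurable _ _ compactG phi.
have bF : mbounded_measurable F.
  apply: mbounded_measurableM => // i j.
  under eq_fun do rewrite !mxE; apply: cbounded_measurable_conj; exact: bV.
pose H := mE mu F.
have HE (y : G) : H *m phi y = adjmx (phi y^-1%g) *m H.
  have H_inv : adjmx (phi y^-1%g) *m H *m phi y^-1%g = H.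
    rewrite -mE_mull// -mE_mulr; last first.
      by apply: mbounded_measurableM => //; exact: mbounded_measurable_cst.
    rewrite -[RHS](mE_haar haar_mu y bF); apply: eq_mE => x.
    by rewrite /F invgM rmxM adjmxM !mulmxA.
  by rewrite -[in LHS]H_inv -mulmxA -rmxM mulVg rmx1 mulmx1.
have Hunit : H \in unitmx.
  apply: cV_ker0_unitmx => u Hu0; apply/eqP; apply: contraT => u0.
  (* [q x] is the squared norm of phi(x^-1) u, positive because phi(x^-1) is invertible; its mean
     u^* H u would be zero if H u = 0. *)
  pose q x := (adjmx u *m F x *m u) 0 0.
  have bq : mbounded_measurable (fun x => adjmx u *m F x *m u).
    by do 2 ?apply: mbounded_measurableM => //; exact: mbounded_measurable_cst.
  have : cE mu q != 0.
    apply: cE_gt0_neq0; first exact: bq.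
    move=> x; pose w := phi (x : G)^-1%g *m u.
    have -> : q x = (adjmx w *m w) 0 0.
      by rewrite /q /F /w adjmxM !mulmxA.
    apply: adjmx_mul_gt0; apply: contra u0 => /eqP e.
    by rewrite -[u]mul1mx -(rmx1 phi) -(mulgV (x : G)) rmxM -mulmxA -/w e mulmx0.
  have -> : cE mu q = mE mu (fun x => adjmx u *m F x *m u) 0 0 by rewrite mxE.
  rewrite mE_mulr; last first.
    by apply: mbounded_measurableM => //; exact: mbounded_measurable_cst.
  by rewrite mE_mull// -mulmxA Hu0 mulmx0 mxE eqxx.
rewrite -[LHS]conjcK; congr conjc.
rewrite /rep_char -mxtrace_adjmx -[adjmx _]mulmx1 -(mulmxV Hunit) mulmxA -HE.
by rewrite mxtrace_mulC mulmxA mulVmx// mul1mx.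
Qed.

End UnitaryTrick.

(** * Multiplicities *)

Section Multiplicity.
Context {R : realType} {G : topologicalGroupType}.
Local Notation C := R[i].
Implicit Types phi psi rho : rep R G.

Definition irr_seq (s : seq (rep R G)) : Prop :=
  forall phi, phi \in s -> rep_irreducible phi.

Definition iso_count phi (s : seq (rep R G)) : nat :=
  count (fun psi => `[< rep_iso phi psi >]) s.

Lemma rep_choice_iso phi : rep_iso phi (rep_choice phi).
Proof.
rewrite /rep_choice; case: xgetP => [psi -> //|/(_ phi)[]].
exact: rep_iso_refl.
Qed.

Lemma rep_choice_eq phi psi : rep_iso phi psi -> rep_choice phi = rep_choice psi.
Proof.
move=> h; congr xget; apply/seteqP; split=> rho /= h'.
  exact: rep_iso_trans (rep_iso_sym h) h'.
exact: rep_iso_trans h h'.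
Qed.

(** Turns isomorphism into equality of representatives, so that counting up to isomorphism becomes
    counting occurrences in a list. *)
Lemma irr_dual_isoE phi psi : irr_dual R G psi ->
  `[< rep_iso psi phi >] = (rep_choice phi == psi).
Proof.
move=> [_ psiE]; apply/asboolP/eqP => [/rep_choice_eq <- //|<-].
exact/rep_iso_sym/rep_choice_iso.
Qed.

Lemma irr_dual_choice phi : rep_irreducible phi -> irr_dual R G (rep_choice phi).
Proof.
move=> irr; split; first exact: rep_iso_irreducible (rep_choice_iso phi) irr.
exact/esym/rep_choice_eq/rep_choice_iso.
Qed.

(** Regroups a list by isomorphism class. The sum over the dual has finite support because
    [iso_count] vanishes off the representatives of members of [s]. *)
Lemma sum_irr_dual (s : seq (rep R G)) (f : rep R G -> C) : irr_seq s ->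
  (forall phi psi, rep_iso phi psi -> f phi = f psi) ->
  \sum_(phi \in irr_dual R G) (iso_count phi s)%:R * f phi =
  \sum_(phi <- s) f phi.
Proof.
move=> irr_s f_iso; set r := undup (map (@rep_choice R G) s).
have r_dual phi : phi \in r -> irr_dual R G phi.
  rewrite mem_undup => /mapP[psi psi_s ->]; apply: irr_dual_choice; exact: irr_s.
have countE phi : irr_dual R G phi ->
    iso_count phi s = count_mem phi (map (@rep_choice R G) s).
  move=> dphi; rewrite count_map; apply: eq_count => psi /=.
  exact: irr_dual_isoE.
rewrite (@fsbigE _ _ _ _ _ r)//=; first last.
- move=> phi dphi; rewrite mem_undup => phi_s.
  by rewrite countE// (count_memPn phi_s) mul0r.
- exact: undup_uniq.
transitivity (\sum_(phi <- map (@rep_choice R G) s) f phi).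
  rewrite -[RHS]big_undup_iterop_count [LHS]big_seq_cond [RHS]big_seq_cond.
  apply: eq_big => [phi|phi /andP[/r_dual dphi _]].
    by rewrite andbT; apply: andb_idr => /r_dual dphi; rewrite inE.
  by rewrite countE// mulr_natl.
by rewrite big_map; apply: eq_bigr => phi _; apply/esym/f_iso/rep_choice_iso.
Qed.

End Multiplicity.

Section HaarMultiplicity.
Context {R : realType} {G : topologicalGroupType}.
Hypothesis compactG : compact [set: G].
Variable mu : probability (borelType G) R.
Hypothesis haar_mu : is_haar mu.
Local Notation C := R[i].
Implicit Types phi psi rho : rep R G.

Lemma iso_count_cE (s : seq (rep R G)) phi rho :
  irr_seq s -> rep_irreducible phi ->
  (forall x, rep_char rho x = \sum_(psi <- s) rep_char psi x) ->
  (iso_count phi s)%:R =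
    cE mu (fun x : G => rep_char phi x * rep_char rho x^-1%g).
Proof.
move=> irr_s irr_phi rhoE.
under eq_cE do rewrite rhoE mulr_sumr.
rewrite cE_sum; last first.
  move=> psi; apply: (@cbounded_measurableM _ _ (borelType G)).
    exact: rep_char_bounded_measurable.
  apply: (@ccontinuous_bounded_measurable _ _ compactG (fun x => rep_char psi x^-1%g)).
  apply: (@ccontinuous_comp _ _ _ (rep_char psi)); first exact: invg_continuous.
  exact: rep_char_continuous.
rewrite big_seq (eq_bigr (fun psi => `[< rep_iso phi psi >]%:R)); last first.
  by move=> psi /irr_s irr_psi; rewrite irr_char_orthonormal.
by rewrite -big_seq -natr_sum -big_mkcond sum1_count.
Qed.

(** Makes the choice inside [rep_mult] harmless: every decomposition yields the same integral, and
    one exists, so the default 0 is never taken for lack of a decomposition. *)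
Lemma rep_mult_cE phi rho : rep_irreducible phi ->
  (rep_mult phi rho)%:R =
    cE mu (fun x : G => rep_char phi x * rep_char rho x^-1%g).
Proof.
move=> irr_phi; rewrite /rep_mult; case: xgetP => [m -> [s [irr_s iso ->]]|].
  rewrite -(@iso_count_cE s)// => [_ /(nthP (rep_triv R G))[i si <-]|x].
    exact: irr_s.
  by rewrite (rep_iso_char iso) rep_char_bigsum.
have [s irr_s iso] := rep_complete_reducible compactG haar_mu rho.
move=> /(_ (iso_count phi s))[]; exists s; split=> // i si.
by apply: irr_s; rewrite mem_nth.
Qed.

Lemma rep_mult_iso_count (s : seq (rep R G)) phi rho :
  irr_seq s -> rep_irreducible phi -> rep_iso rho (rep_bigsum s) ->
  rep_mult phi rho = iso_count phi s.
Proof.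
move=> irr_s irr_phi iso; apply/eqP; rewrite -(eqr_nat C); apply/eqP.
rewrite rep_mult_cE// (@iso_count_cE s _ rho)// => x.
by rewrite (rep_iso_char iso) rep_char_bigsum.
Qed.

End HaarMultiplicity.

(** * Moments of the random pair *)

Section RandomPair.
Context {R : realType} {G : topologicalGroupType}.
Hypothesis compactG : compact [set: G].
Variable mu : probability (borelType G) R.
Hypothesis haar_mu : is_haar mu.
Context {d : measure_display} {Omega : measurableType d}
  (P : probability Omega R) (g alpha' : {RV P >-> borelType G}) (alpha : G).
Hypothesis law_g : has_law P g mu.
Hypothesis law_alpha' : has_law P alpha' (uniform_conj_class mu alpha).
Hypothesis indep : independent_RV P g alpha'.
Local Notation C := R[i].
Implicit Types phi psi rho : rep R G.

Let bm (F : G -> C) := cbounded_measurable (F : borelType G -> C).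

Lemma cE_haar_rv (F : G -> C) : bm F ->
  cE P (fun w => F (g w)) = cE mu F.
Proof.
by move=> mF; apply: (@cE_comp _ _ _ _ _ P mu g F).
Qed.

Lemma cE_conj_class_rv (F : G -> C) : bm F ->
  cE P (fun w => F (alpha' w)) =
  cE mu (fun h : G => F (h * alpha * h^-1)%g).
Proof.
move=> mF.
rewrite -[LHS]/(cE P (F \o alpha')).
(* [uniform_conj_class] is a bare set function, not a bundled probability, so the law of [alpha'] is
   the common target of two changes of variable. *)
rewrite (@cE_comp _ _ _ _ _ P (distribution P alpha') alpha' F)//.
symmetry.
apply: (@cE_comp _ _ _ _ _ mu (distribution P alpha')
  (fun h : G => h * alpha * h^-1)%g F) => //.
  exact: (continuous_borel_measurable (@conjg_continuous _ alpha)).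
by move=> A mA; exact/esym/law_alpha'.
Qed.

(** Matrix entries separate the variables in the trace of phi(alpha') phi(g), and independence
    factors each term. The mean of phi(alpha') is scalar, so only diagonal terms survive. *)
Lemma cE_irr_char_mul phi (F : G -> C) : rep_irreducible phi -> bm F ->
  cE P (fun w => rep_char phi ((alpha' w : G) * (g w : G))%g * F (g w)) =
  rep_char phi alpha / (rdim phi)%:R * cE mu (fun x => rep_char phi x * F x).
Proof.
move=> irr mF; have mphi := @rep_bounded_measurable _ _ compactG phi.
have mphiF i j : bm (fun x => phi x i j * F x).
  by apply: (@cbounded_measurableM _ _ (borelType G)) => //; exact: mphi.
have entry i j : cE P (fun w => phi (alpha' w) i j) =
    ((rep_char phi alpha / (rdim phi)%:R)%:M : 'M[C]_(rdim phi)) i j.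
  by rewrite (cE_conj_class_rv (mphi i j))
    -(mE_rep_conj compactG haar_mu alpha irr) mxE.
transitivity (cE P (fun w => \sum_i \sum_j
    (phi (g w) j i * F (g w)) * phi (alpha' w) i j)).
  apply: eq_cE => w; rewrite /rep_char rmxM /mxtrace mulr_suml.
  apply: eq_bigr => i _; rewrite mxE mulr_suml; apply: eq_bigr => j _.
  by rewrite -mulrA mulrC.
have mterm i j : cbounded_measurable
    (fun w => (phi (g w) j i * F (g w)) * phi (alpha' w) i j).
  apply: cbounded_measurableM.
    exact: (cbounded_measurable_comp (measurable_funPT g) (mphiF j i)).
  exact: (cbounded_measurable_comp (measurable_funPT alpha') (mphi i j)).
rewrite cE_sum; last by move=> i; apply: cbounded_measurable_sum => j; exact: mterm.
transitivity (\sum_i (rep_char phi alpha / (rdim phi)%:R) *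
    cE mu (fun x => phi x i i * F x)).
  apply: eq_bigr => i _; rewrite cE_sum//.
  rewrite (bigD1 i)//= big1 => [|j ji].
    rewrite (cE_indep indep (mphiF i i) (mphi i i)) addr0 mulrC.
    by congr (_ * _); [rewrite [LHS]entry mxE eqxx | exact: cE_haar_rv].
  rewrite (cE_indep indep (mphiF j i) (mphi i j)).
  by rewrite [X in _ * X]entry mxE eq_sym (negbTE ji) mulr0n mulr0.
rewrite -mulr_sumr -cE_sum; last by move=> i; exact: mphiF.
by congr (_ * _); apply: eq_cE => x; rewrite /rep_char /mxtrace mulr_suml.
Qed.

Lemma cE_char_mul (s : seq (rep R G)) rho (F : G -> C) : irr_seq s ->
  (forall x, rep_char rho x = \sum_(phi <- s) rep_char phi x) -> bm F ->
  cE P (fun w => rep_char rho ((alpha' w : G) * (g w : G))%g * F (g w)) =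
  \sum_(phi <- s) rep_char phi alpha / (rdim phi)%:R *
    cE mu (fun x => rep_char phi x * F x).
Proof.
move=> irr_s rhoE mF.
transitivity (cE P (fun w => \sum_(phi <- s)
    (rep_char phi ((alpha' w : G) * (g w : G))%g * F (g w)))).
  by apply: eq_cE => w; rewrite rhoE mulr_suml.
rewrite cE_sum => [|phi]; last first.
  apply: cbounded_measurableM; last first.
    exact: (cbounded_measurable_comp (measurable_funPT g) mF).
  have mphi := @rep_bounded_measurable _ _ compactG phi.
  under eq_fun do rewrite /rep_char rmxM /mxtrace.
  apply: cbounded_measurable_sum => i; under eq_fun do rewrite mxE.
  apply: cbounded_measurable_sum => j; apply: cbounded_measurableM.
    exact: (cbounded_measurable_comp (measurable_funPT alpha') (mphi i j)).
  exact: (cbounded_measurable_comp (measurable_funPT g) (mphi j i)).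
rewrite big_seq [RHS]big_seq; apply: eq_bigr => phi /irr_s irr_phi.
exact: cE_irr_char_mul.
Qed.

End RandomPair.

(** * Multiplicity sums and moments for a real character *)

Section RealCharacter.
Context {R : realType} {G : topologicalGroupType}.
Hypothesis compactG : compact [set: G].
Variable mu : probability (borelType G) R.
Hypothesis haar_mu : is_haar mu.
Variable tau : rep R G.
Hypothesis real_tau : forall x : G, rep_char tau x \is Num.real.
Local Notation C := R[i].
Local Notation mult phi r := (rep_mult phi (rep_tensor_pow tau r)).
Local Notation ratio phi a := (rep_char phi a / (rdim phi)%:R).
Implicit Types phi psi rho : rep R G.

Lemma real_tensor_charV r x :
  rep_char (rep_tensor_pow tau r) x^-1%g = rep_char (rep_tensor_pow tau r) x.
Proof.
rewrite !rep_char_tensor_pow (rep_charV compactG haar_mu).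
by rewrite -(RRe_real (real_tau x)) conjc_real.
Qed.

Lemma mult_cE phi r : rep_irreducible phi -> (mult phi r)%:R =
  cE mu (fun x : G => rep_char phi x * rep_char (rep_tensor_pow tau r) x).
Proof.
move=> irr; rewrite (rep_mult_cE compactG haar_mu)//.
by apply: eq_cE => x; rewrite real_tensor_charV.
Qed.

(** The two multiplicities play different roles: the one in tau^r is absorbed by running through the
    constituents [s], the one in tau^t becomes an integral. This is the shape that [cE_char_mul]
    produces. *)
Lemma sum_irr_dual_mult r t (f : rep R G -> C) (s : seq (rep R G)) :
  (forall phi psi, rep_iso phi psi -> f phi = f psi) ->
  irr_seq s -> rep_iso (rep_tensor_pow tau r) (rep_bigsum s) ->
  \sum_(phi \in irr_dual R G) (mult phi r)%:R * (mult phi t)%:R * f phi =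
  \sum_(phi <- s)
    cE mu (fun x : G => rep_char phi x * rep_char (rep_tensor_pow tau t) x) * f phi.
Proof.
move=> f_iso irr_s iso; rewrite -[RHS]sum_irr_dual//; last first.
  move=> phi psi h; rewrite (f_iso _ _ h); congr (_ * _).
  by apply: eq_cE => x; rewrite (rep_iso_char h).
apply: eq_fsbigr => phi /set_mem[irr_phi _].
rewrite (rep_mult_iso_count compactG haar_mu irr_s irr_phi iso) -mulrA.
by rewrite mult_cE.
Qed.

Lemma ratio_iso a phi psi : rep_iso phi psi -> ratio phi a = ratio psi a.
Proof. by move=> iso; rewrite (rep_iso_char iso) (rep_iso_rdim iso). Qed.

Lemma tensor_pow_decomposition r : exists s : seq (rep R G),
  [/\ irr_seq s, rep_iso (rep_tensor_pow tau r) (rep_bigsum s) &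
    forall x, rep_char tau x ^+ r = \sum_(phi <- s) rep_char phi x].
Proof.
have [s irr_s iso] :=
  rep_complete_reducible compactG haar_mu (rep_tensor_pow tau r).
exists s; split=> // x.
by rewrite -rep_char_tensor_pow (rep_iso_char iso) rep_char_bigsum.
Qed.

Lemma char_tau_exp_bounded_measurable r :
  cbounded_measurable (fun x : borelType G => rep_char tau x ^+ r).
Proof. by apply: cbounded_measurableX; exact: rep_char_bounded_measurable. Qed.

(** Parseval's identity for the real class functions chi_tau^r and chi_tau^t. *)
Lemma sum_mult_sq r t :
  \sum_(phi \in irr_dual R G) ((mult phi r)%:R * (mult phi t)%:R : C) =
  cE mu (fun x : G => rep_char tau x ^+ (r + t)).
Proof.
have [s [irr_s iso sE]] := tensor_pow_decomposition r.
have := @sum_irr_dual_mult r t (fun=> 1 : C) s (fun _ _ _ => erefl) irr_s iso.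
under eq_fsbigr do rewrite mulr1.
move=> ->; under eq_bigr do rewrite mulr1.
rewrite -cE_sum => [|phi].
  apply: eq_cE => x; rewrite -mulr_suml -sE rep_char_tensor_pow.
  by rewrite -exprD.
by apply: (@cbounded_measurableM _ _ (borelType G));
  exact: rep_char_bounded_measurable.
Qed.

Context {d : measure_display} {Omega : measurableType d}
  (P : probability Omega R) (g alpha' : {RV P >-> borelType G}) (alpha : G).
Hypothesis law_g : has_law P g mu.
Hypothesis law_alpha' : has_law P alpha' (uniform_conj_class mu alpha).
Hypothesis indep : independent_RV P g alpha'.

Let chi_ag w := rep_char tau ((alpha' w : G) * (g w : G))%g.
Let chi_g w := rep_char tau (g w).

Lemma mixed_moment r t :
  cE P (fun w => chi_ag w ^+ r * chi_g w ^+ t) =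
  \sum_(phi \in irr_dual R G)
    ((mult phi r)%:R * (mult phi t)%:R * ratio phi alpha).
Proof.
have [s [irr_s iso sE]] := tensor_pow_decomposition r.
rewrite (@sum_irr_dual_mult r t (fun phi => ratio phi alpha) s)//;
  last exact: ratio_iso.
transitivity (cE P (fun w =>
    rep_char (rep_tensor_pow tau r) ((alpha' w : G) * (g w : G))%g * chi_g w ^+ t)).
  by apply: eq_cE => w; rewrite rep_char_tensor_pow.
rewrite (cE_char_mul compactG haar_mu law_g law_alpha' indep irr_s _
  (char_tau_exp_bounded_measurable t)).
  apply: eq_bigr => phi _; rewrite mulrC; congr (_ * _).
  by apply: eq_cE => x; rewrite rep_char_tensor_pow.
by move=> x; rewrite rep_char_tensor_pow.
Qed.

(** This closed form and the next one, compared with [mixed_moment], evaluate the sums over the dual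
    for r = 0 and r = 1 without identifying the multiplicities in tau^0 and tau^1. *)
Lemma mixed_moment0 t :
  cE P (fun w => chi_ag w ^+ 0 * chi_g w ^+ t) =
  cE mu (fun x : G => rep_char tau x ^+ t).
Proof.
rewrite -(cE_haar_rv law_g (char_tau_exp_bounded_measurable t)).
by apply: eq_cE => w; rewrite mul1r.
Qed.

Lemma mixed_moment1 t : rep_irreducible tau ->
  cE P (fun w => chi_ag w ^+ 1 * chi_g w ^+ t) =
  ratio tau alpha * cE mu (fun x : G => rep_char tau x ^+ t.+1).
Proof.
move=> irr; rewrite -[LHS]/(cE P (fun w => chi_ag w * chi_g w ^+ t)).
rewrite (cE_irr_char_mul compactG haar_mu law_g law_alpha' indep irr
  (char_tau_exp_bounded_measurable t)).
by congr (_ * _); apply: eq_cE => x; rewrite exprS.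
Qed.

Lemma chi_ag_bounded_measurable : cbounded_measurable chi_ag.
Proof.
have mtau := @rep_bounded_measurable _ _ compactG tau.
rewrite /chi_ag; under eq_fun do rewrite /rep_char rmxM /mxtrace.
apply: cbounded_measurable_sum => i; under eq_fun do rewrite mxE.
apply: cbounded_measurable_sum => j; apply: cbounded_measurableM.
  exact: (cbounded_measurable_comp (measurable_funPT alpha') (mtau i j)).
exact: (cbounded_measurable_comp (measurable_funPT g) (mtau j i)).
Qed.

Lemma chi_g_bounded_measurable : cbounded_measurable chi_g.
Proof.
exact: (cbounded_measurable_comp (measurable_funPT g)
  (rep_char_bounded_measurable compactG tau)).
Qed.

Lemma moment_diff (k : nat) :
  exists2 e : R,
    ('E_P[fun w => ((complex.Re (chi_ag w) - complex.Re (chi_g w)) ^+ k)%R] =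
      e%:E)%E &
    e%:C = \sum_(0 <= r < k.+1) (-1) ^+ (k - r) * 'C(k, r)%:R *
      \sum_(phi \in irr_dual R G)
        ((mult phi r)%:R * (mult phi (k - r))%:R * ratio phi alpha).
Proof.
have [mag _] := chi_ag_bounded_measurable; have [mg _] := chi_g_bounded_measurable.
have mdiff : bounded_measurable
    (fun w => (complex.Re (chi_ag w) - complex.Re (chi_g w)) ^+ k).
  elim: k => [|k IH].
    by under eq_fun do rewrite expr0; exact: bounded_measurable_cst.
  under eq_fun do rewrite exprS; apply: bounded_measurableM => //.
  by apply: bounded_measurableD => //; exact: bounded_measurableN.
have [e Ee eC] := expectation_cE P mdiff; exists e => //; rewrite eC.
transitivity (cE P (fun w => \sum_(r < k.+1)
    ((-1) ^+ (k - r) * 'C(k, r)%:R) * (chi_ag w ^+ r * chi_g w ^+ (k - r)))).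
  (* The character is real, so the real parts in the statement are the character values
     themselves. *)
  apply: eq_cE => w; rewrite rmorphXn rmorphB /= !RRe_real ?real_tau//.
  (* [exprDn] puts the decreasing exponent on its first summand, which must therefore be the negated
     one. *)
  rewrite addrC exprDn; apply: eq_bigr => r _.
  rewrite -[LHS]mulr_natl [(- chi_g w) ^+ _]exprNn -!mulrA [RHS]mulrCA.
  by rewrite (mulrC (chi_g w ^+ _)).
rewrite cE_sum => [|r].
  rewrite big_mkord; apply: eq_bigr => r _.
  rewrite cEZl ?mixed_moment//.
  by apply: cbounded_measurableM; apply: cbounded_measurableX;
    [exact: chi_ag_bounded_measurable | exact: chi_g_bounded_measurable].
apply: cbounded_measurableM; first exact: cbounded_measurable_cst.
by apply: cbounded_measurableM; apply: cbounded_measurableX;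
  [exact: chi_ag_bounded_measurable | exact: chi_g_bounded_measurable].
Qed.

(* The sum over r is symmetric under r -> 4 - r, and its terms r = 0, 1 are
   multiples of the fourth moment, that is of the sum of m_phi(tau^2)^2. *)
Lemma fourth_moment_sum : rep_irreducible tau ->
  \sum_(0 <= r < 5) (-1) ^+ (4 - r) * 'C(4, r)%:R *
      \sum_(phi \in irr_dual R G)
        ((mult phi r)%:R * (mult phi (4 - r))%:R * ratio phi alpha) =
  \sum_(phi \in irr_dual R G)
      ((mult phi 2)%:R ^+ 2 *
       (8 * (1 - ratio tau alpha) - 6 * (1 - ratio phi alpha))) :> C.
Proof.
move=> irr; pose S r t := \sum_(phi \in irr_dual R G)
  ((mult phi r)%:R * (mult phi t)%:R * ratio phi alpha) : C.
have SC r t : S r t = S t r.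
  by apply: eq_fsbigr => phi _; rewrite (mulrC (mult phi r)%:R).
pose M4 := cE mu (fun x : G => rep_char tau x ^+ 4).
have S04 : S 0%N 4%N = M4 by rewrite /S -mixed_moment mixed_moment0.
have S13 : S 1%N 3%N = ratio tau alpha * M4 by rewrite /S -mixed_moment mixed_moment1.
(* With a and b the ratios of [tau] and [phi], 8(1 - a) - 6(1 - b) = 2 - 8a + 6b. Here 2 and 8 are
   twice the binomials of r = 0 and r = 1, by symmetry, and 6 is that of r = 2. *)
have -> : \sum_(phi \in irr_dual R G) ((mult phi 2)%:R ^+ 2 *
    (8 * (1 - ratio tau alpha) - 6 * (1 - ratio phi alpha))) =
    (2 - 8 * ratio tau alpha) * M4 + 6 * S 2%N 2%N :> C.
  (* All three sums are moved to the same finite list of constituents of tau^2, where linearity is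
     available term by term. *)
  have [s [irr_s iso sE]] := tensor_pow_decomposition 2.
  have fE (f : rep R G -> C) := fun hf => @sum_irr_dual_mult 2 2 f s hf irr_s iso.
  have M4E := sum_mult_sq 2 2.
  under [LHS]eq_fsbigr do rewrite expr2.
  rewrite fE => [|phi psi h]; last by rewrite (ratio_iso _ h).
  rewrite /S fE => [|phi psi h]; last by rewrite (ratio_iso _ h).
  have -> : M4 = \sum_(phi <- s)
      cE mu (fun x : G => rep_char phi x * rep_char (rep_tensor_pow tau 2) x) * 1.
    rewrite -fE// /M4 -M4E; apply: eq_fsbigr => phi _; by rewrite mulr1.
  rewrite !mulr_sumr -big_split; apply: eq_bigr => phi _ /=; ring.
rewrite 5?big_ltn// big_geq// addr0.
have SE r : \sum_(phi \in irr_dual R G) ((mult phi r)%:R * (mult phi (4 - r))%:R *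
  ratio phi alpha) = S r (4 - r)%N by [].
rewrite !SE !(subSS, subn0, subnn) (SC 3%N) (SC 4%N) S04 S13.
have -> : 'C(4, 2) = 6%N by []; have -> : 'C(4, 3) = 4%N by [].
by rewrite bin0 bin1 binn; ring.
Qed.

End RealCharacter.

Theorem lemma3p6 (R : realType) (G : lieGroupType R)
    (compactG : compact [set: G])
    (mu : probability (borelType G) R) (haar_mu : is_haar mu)
    (tau : rep R G) (irr_tau : rep_irreducible tau)
    (ntriv_tau : ~ rep_iso tau (rep_triv R G))
    (real_tau : forall x : G, rep_char tau x \is Num.real)
    (alpha : G) (self_inv_alpha : self_inverse_class (conj_class alpha))
    (d : measure_display) (Omega : measurableType d) (P : probability Omega R)
    (g alpha' : {RV P >-> borelType G})
    (law_g : has_law P g mu)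
    (law_alpha' : has_law P alpha' (uniform_conj_class mu alpha))
    (indep : independent_RV P g alpha')
    (k : nat) (k_gt0 : (0 < k)%N) :
  let W := fun w : Omega => complex.Re (rep_char tau (g w)) in
  let W' := fun w : Omega =>
    complex.Re (rep_char tau ((alpha' w : G) * (g w : G))%g) in
  (exists2 e : R, ('E_P[fun w => ((W' w - W w) ^+ k)%R] = e%:E)%E &
    e%:C = \sum_(0 <= r < k.+1)
      (-1) ^+ (k - r) * 'C(k, r)%:R *
      \sum_(phi \in irr_dual R G)
        ((rep_mult phi (rep_tensor_pow tau r))%:R *
         (rep_mult phi (rep_tensor_pow tau (k - r)))%:R *
         (rep_char phi alpha / (rdim phi)%:R))) /\
  (exists2 e : R, ('E_P[fun w => ((W' w - W w) ^+ 4)%R] = e%:E)%E &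
    e%:C = \sum_(phi \in irr_dual R G)
      ((rep_mult phi (rep_tensor_pow tau 2))%:R ^+ 2 *
       (8 * (1 - rep_char tau alpha / (rdim tau)%:R) -
        6 * (1 - rep_char phi alpha / (rdim phi)%:R)))).
Proof.
move=> W W'.
have moments := moment_diff compactG haar_mu real_tau law_g law_alpha' indep.
split; first exact: moments.
have [e Ee eE] := moments 4%N; exists e => //; rewrite eE.
exact: (fourth_moment_sum compactG haar_mu real_tau law_g law_alpha' indep irr_tau).
Qed.
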